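(* Let $\lambda$ be a partition of $n$ and fix a removable node $(k,l)=(k_0,l_0)$ of $\lambda$. Let $(k_1,l_1),\dots,(k_N,l_N)$ ($N\ge0$) be the removable nodes of $\lambda$ strictly below $(k,l)$, ordered so that $k_0<k_1<\cdots<k_N$. Put $c_j:=t^\lambda[k_j,l_j]$, $c:=c_0$, $t_d:=t^\lambda\sigma_{c,d}$ for $d\ge c$, $e_d:=e_{t_d}$, $f_d:=f_{t_d}$. For each row index $i$ let $a_i$ (resp. $b_i$) be the last entry of row $i-1$ (resp. row $i$) of $t^\lambda$ and $R_i:=1+T_{a_i,a_i+1}+\cdots+T_{a_i,b_i-1}\in\mathcal H_n$. For $j=0,\dots,N-1$ put $\widetilde\sigma_j:=\sigma_{c_j,c_{j+1}}$ and $\widetilde\sigma_j^{\,i}:=\sigma_{c_j,c_j+i\,l_{j+1}}$; set $\varphi_j^1:=R_{k_j+1}$ and recursively, for $i=2,\dots,k_{j+1}-k_j$, $$\varphi_j^i:=\big(T_{\widetilde\sigma_j^{\,i-1}}-q\,\varphi_j^{i-1}\big)R_{k_j+i},$$ and $\mathcal F_j:=\varphi_j^{k_{j+1}-k_j}$. Let $r_j$ be the radial distance in $\lambda$ from the node $(k_j,l_j)$ to the node $(k,l)$. Define $\tilde f_0:=e_\lambda$ and recursively $$\tilde f_{j+1}:=\tilde f_j\Big(T_{\widetilde\sigma_j}+\frac{1}{[r_{j+1}]_q}\mathcal F_j\Big),\qquad j=0,\dots,N-1.$$ Then $\tilde f_N=f_n$ (the seminormal basis vector $f_{t_n}$). Moreover,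 when the recursion is multiplied out and each $e_tT_i$ is evaluated as $e_{ts_i}$, all the $e_t$ that arise have $t$ standard.
   Context: $\mathcal A=\mathbb C[q,q^{-1}]$, $\mathcal K=\mathbb C(q)$. $\mathcal H_{\mathcal A,n}$ is the Iwahori–Hecke algebra over $\mathcal A$ with generators $T_1,\dots,T_{n-1}$ and relations $T_iT_j=T_jT_i$ for $|i-j|>1$, $T_iT_jT_i=T_jT_iT_j$ for $|i-j|=1$, $(T_i-q)(T_i+1)=0$; $\mathcal H_n=\mathcal H_{\mathcal A,n}\otimes\mathcal K$. Permutations are composed left to right; $s_i=(i,i+1)$; $T_w=T_{i_1}\cdots T_{i_N}$ for a reduced expression $w=s_{i_1}\cdots s_{i_N}$. For $i\le j$, $\sigma_{i,j}=(i,i+1)(i+1,i+2)\cdots(j-1,j)$ ($\sigma_{i,i}=1$), $T_{i,j}=T_{\sigma_{i,j}}=T_i\cdots T_{j-1}$. $[k]_q=(q^k-1)/(q-1)$. Nodes $(r,c)$ = (row, column); $t[r,c]$ is the entry of $t$ in node $(r,c)$. A node is removable if deleting it leaves a partition diagram. A $\lambda$-tableau is a bijective filling of the diagram with $1,\dots,n$; standard = increasing along rows and columns. $t^\lambda$ has $1,\dots,n$ filled along rows, top first. $S_n$ acts on the right on tableaux by permuting entries; $t=t^\lambda d(t)$ defines $d(t)$. Radial distance from $(a,b)$ to $(a',b')$ is $b'-b-(a'-a)$. Specht module: $x_\lambda=\sum_{w\in S_\lambda}T_w$ ($S_\lambda$ the row stabilizer of $t^\lambda$), $x_{st}=T_{d(s)^{-1}}x_\lambda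 T_{d(t)}$, $\overline N_\lambda$ the $\mathcal A$-span of $x_{st}$ for $\mu$-tableaux $s,t$ with $\mu$ strictly dominating $\lambda$; $S^\lambda_{\mathcal A}$ is the right module generated by $x_\lambda+\overline N_\lambda$; $e_t:=x_{t^\lambda t}+\overline N_\lambda=e_{t^\lambda}T_{d(t)}$ for any $\lambda$-tableau $t$, $e_\lambda=e_{t^\lambda}$; $S^\lambda=S^\lambda_{\mathcal A}\otimes\mathcal K$. Seminormal basis: $L_m=\sum_{i=1}^{m-1}q^{-i}T_{(m-i,m)}$; residue of $(r,c)$ is $[c-r]_q$; $r_t(m)$ = residue of the node of $m$ in $t$; $\mathrm R$ = set of residues of nodes of partitions of $n$; $E_t=\prod_{m=1}^n\prod_{c'\in\mathrm R\setminus\{r_t(m)\}}\frac{L_m-c'}{r_t(m)-c'}$, $f_t=e_tE_t\in S^\lambda$. *)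

(* Defs.v *)
From mathcomp Require Import all_boot all_order all_algebra all_fingroup.
From mathcomp Require Import complex fraction reals.
Set Implicit Arguments.
Unset Strict Implicit.
Unset Printing Implicit Defensive.
Import GRing.Theory.
Local Open Scope ring_scope.

(* Partitions and tableaux combinatorics (all nodes / entries 1-indexed
   as in the paper; a row index r refers to row r, entries are 1..n).  *)

Definition is_partition (m : nat) (la : seq nat) : bool :=
  [&& sorted geq la, all (fun x => 0 < x)%N la & sumn la == m].

Definition part_sum (la : seq nat) (r : nat) : nat := sumn (take r la).

Definition lam (la : seq nat) (r : nat) : nat := nth 0%N la r.-1.

Definition dominates (mu la : seq nat) : Prop :=
  forall r, (part_sum la r <= part_sum mu r)%N.
Definition strictly_dominates (mu la : seq nat) : Prop :=
  dominates mu la /\ mu <> la.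

Definition in_diagram (la : seq nat) (rc : nat * nat) : bool :=
  [&& (0 < rc.1)%N, (rc.1 <= size la)%N, (0 < rc.2)%N & (rc.2 <= lam la rc.1)%N].

(* removable node: deleting it leaves a partition diagram, i.e. it is the
   last node of its row and the next row is strictly shorter *)
Definition removable (la : seq nat) (rc : nat * nat) : bool :=
  [&& in_diagram la rc, rc.2 == lam la rc.1 & (lam la rc.1.+1 < rc.2)%N].

Definition tla (la : seq nat) (rc : nat * nat) : nat :=
  (part_sum la rc.1.-1 + rc.2)%N.

Definition nodes (la : seq nat) : seq (nat * nat) :=
  flatten [seq [seq (r.+1, c.+1) | c <- iota 0 (nth 0%N la r)] | r <- iota 0 (size la)].

Fixpoint parts_le (fuel m b : nat) : seq (seq nat) :=
  match fuel with
  | 0 => if m == 0%N then [:: [::]] else [::]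
  | f.+1 => if m == 0%N then [:: [::]] else
      flatten [seq [seq p :: s | s <- parts_le f (m - p) p] | p <- iota 1 (minn m b)]
  end.
Definition partitions (m : nat) : seq (seq nat) :=
  [seq la <- parts_le m m m | is_partition m la].

(* 0-indexed row (0 .. size la - 1) of the 0-indexed entry x of t^lambda *)
Definition row_of (la : seq nat) (x : nat) : nat :=
  find (fun r => (x < part_sum la r.+1)%N) (iota 0 (size la)).

Section Hecke.
Variables (K : fieldType) (q : K) (n : nat).

Definition tpermN (a b : nat) : 'S_n :=
  if (insub a, insub b) is (Some a', Some b') then tperm a' b' else 1%g.

(* s_i = (i, i+1) on entries 1..n (i is 1-indexed) *)
Definition sgen (i : nat) : 'S_n := tpermN i.-1 i.

(* sigma_{i,j} = (i,i+1)(i+1,i+2)...(j-1,j), composed left to right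
   (MathComp's product on 'S_n is left-to-right composition:
    (s * t) x = t (s x)) *)
Definition sig (i j : nat) : 'S_n := (\prod_(i <= m < j) sgen m)%g.

Definition perm_len (w : 'S_n) : nat :=
  #|[set p : 'I_n * 'I_n | (p.1 < p.2)%N && (w p.2 < w p.1)%N]|.

(* H_n : elements are K-linear combinations of the basis T_w, w in S_n *)
Definition hecke := {ffun 'S_n -> K}.
Definition hscale (a : K) (h : hecke) : hecke := [ffun w => a * h w].
Definition Tw (w : 'S_n) : hecke := [ffun x => (x == w)%:R].
Definition hone : hecke := Tw 1%g.

Definition rmulTs (h : hecke) (s : 'S_n) : hecke :=
  \sum_(w : 'S_n) hscale (h w)
     (if (perm_len w < perm_len (w * s)%g)%N then Tw (w * s)%g
      else hscale q (Tw (w * s)%g) + hscale (q - 1) (Tw w)).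

(* h * T_w, computed along a reduced expression of w *)
Fixpoint rmulT_fuel (fuel : nat) (h : hecke) (w : 'S_n) : hecke :=
  match fuel with
  | 0 => h
  | f.+1 =>
      if [pick i : 'I_n | (0 < i)%N && (perm_len (w * sgen i)%g < perm_len w)%N]
         is Some i
      then rmulTs (rmulT_fuel f h (w * sgen i)%g) (sgen i)
      else h
  end.
Definition rmulT (h : hecke) (w : 'S_n) : hecke := rmulT_fuel (perm_len w) h w.

Definition hmul (a b : hecke) : hecke := \sum_(w : 'S_n) hscale (b w) (rmulT a w).

Definition qint (k : int) : K := (q ^ k - 1) / (q - 1).

Definition rowstab (la : seq nat) : {set 'S_n} :=
  [set w : 'S_n | [forall x : 'I_n, row_of la (w x) == row_of la x]].
Definition xla (la : seq nat) : hecke := \sum_(w in rowstab la) Tw w.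

(* A lambda-tableau t is encoded by d(t) in S_n (t = t^lambda d(t)).
   Representative in H_n of e_t = x_{t^lambda t} + Nbar_lambda. *)
Definition eT (la : seq nat) (d : 'S_n) : hecke := hmul (xla la) (Tw d).

(* Nbar_lambda: K-span of the x_{st} = T_{d(s)^-1} x_mu T_{d(t)}
   for mu-tableaux s,t (i.e. d(s), d(t) in S_n), mu |- n, mu strictly
   dominating lambda *)
Definition inNbar (la : seq nat) (h : hecke) : Prop :=
  exists s : seq (seq nat * 'S_n * 'S_n * K),
    (forall p, p \in s -> is_partition n p.1.1.1 /\ strictly_dominates p.1.1.1 la) /\
    h = \sum_(p <- s)
          hscale p.2 (hmul (hmul (Tw (p.1.1.2)^-1%g) (xla p.1.1.1)) (Tw p.1.2)).

(* equality in S^lambda of the classes of two representatives *)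
Definition specht_eq (la : seq nat) (h1 h2 : hecke) : Prop := inNbar la (h1 - h2).

Definition entry (la : seq nat) (d : 'S_n) (rc : nat * nat) : nat :=
  if insub (tla la rc).-1 is Some x then (d x).+1 else 0%N.

Definition standard (la : seq nat) (d : 'S_n) : Prop :=
  forall r c, in_diagram la (r, c) ->
    (in_diagram la (r, c.+1) -> (entry la d (r, c) < entry la d (r, c.+1))%N) /\
    (in_diagram la (r.+1, c) -> (entry la d (r, c) < entry la d (r.+1, c))%N).

Definition residue (rc : nat * nat) : K := qint (rc.2%:Z - rc.1%:Z).

Definition rt (la : seq nat) (d : 'S_n) (m : nat) : K :=
  if insub m.-1 is Some x then
    let y := (d^-1)%g x in
    let r := row_of la y in
    residue (r.+1, (y - part_sum la r).+1)
  else 0.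

Definition Rset : seq K :=
  undup (flatten [seq [seq residue rc | rc <- nodes la] | la <- partitions n]).

Definition Lm (m : nat) : hecke :=
  \sum_(1 <= i < m) hscale (q ^- i) (Tw (tpermN (m - i).-1 m.-1)).

Definition Et (la : seq nat) (d : 'S_n) : hecke :=
  \big[hmul/hone]_(1 <= m < n.+1)
    \big[hmul/hone]_(c' <- Rset | c' != rt la d m)
       hscale ((rt la d m - c')^-1) (Lm m - hscale c' hone).

Definition fT (la : seq nat) (d : 'S_n) : hecke := hmul (eT la d) (Et la d).

Section Recursion.
Variables (la : seq nat) (k l : nat).

Definition nodes_below : seq (nat * nat) :=
  [seq (r, lam la r) | r <- iota k.+1 (size la - k) & removable la (r, lam la r)].
Definition NN : nat := size nodes_below.
Definition knode (j : nat) : nat * nat := nth (k, l) ((k, l) :: nodes_below) j.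
Definition kk j := (knode j).1.
Definition ll j := (knode j).2.
Definition cc j := tla la (knode j).

Definition aa (i : nat) := part_sum la i.-1.
Definition bb (i : nat) := part_sum la i.
Definition Rrow (i : nat) : hecke := \sum_(aa i <= j < bb i) Tw (sig (aa i) j).

Definition sigt (j : nat) : 'S_n := sig (cc j) (cc j.+1).
Definition sigti (j i : nat) : 'S_n := sig (cc j) (cc j + i * ll j.+1).

Fixpoint phi (j i : nat) : hecke :=
  match i with
  | 0 => hone
  | i'.+1 => if i' is 0 then Rrow (kk j + 1)
             else hmul (Tw (sigti j i') - hscale q (phi j i')) (Rrow (kk j + i))
  end.
Definition FF (j : nat) : hecke := phi j (kk j.+1 - kk j).

Definition rdist (j : nat) : int := (l%:Z - (ll j)%:Z) - (k%:Z - (kk j)%:Z).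

Fixpoint ftilde (j : nat) : hecke :=
  match j with
  | 0 => xla la
  | j'.+1 => hmul (ftilde j') (Tw (sigt j') + hscale (qint (rdist j'.+1))^-1 (FF j'))
  end.

Definition f_n : hecke := fT la (sig (cc 0) n).

(* ---- formal expansion: linear combinations of words in the T_i ---- *)
Definition fexpr := seq (K * seq nat).
Definition fadd (a b : fexpr) : fexpr := a ++ b.
Definition fscale (x : K) (a : fexpr) : fexpr := [seq (x * p.1, p.2) | p <- a].
Definition fmul (a b : fexpr) : fexpr :=
  [seq (x.1 * y.1, x.2 ++ y.2) | x <- a, y <- b].
Definition fone : fexpr := [:: (1, [::])].
Definition fTij (i j : nat) : fexpr := [:: (1, iota i (j - i))].
Definition fRrow (i : nat) : fexpr := flatten [seq fTij (aa i) j | j <- iota (aa i) (bb i - aa i)].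
Fixpoint fphi (j i : nat) : fexpr :=
  match i with
  | 0 => fone
  | i'.+1 => if i' is 0 then fRrow (kk j + 1)
             else fmul (fadd (fTij (cc j) (cc j + i' * ll j.+1)) (fscale (- q) (fphi j i')))
                       (fRrow (kk j + i))
  end.
Definition fFF (j : nat) : fexpr := fphi j (kk j.+1 - kk j).
(* words w such that e_lambda T_w occurs in the multiplied-out f~_j *)
Fixpoint fexpand (j : nat) : fexpr :=
  match j with
  | 0 => fone
  | j'.+1 => fmul (fexpand j')
                  (fadd (fTij (cc j') (cc j'.+1)) (fscale (qint (rdist j'.+1))^-1 (fFF j')))
  end.

Definition word_perm (w : seq nat) : 'S_n := (\prod_(i <- w) sgen i)%g.

End Recursion.
End Hecke.

Definition Kq (R : realType) : fieldType := {fraction {poly R[i]}}.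
Definition qvar (R : realType) : Kq R := FracField.tofrac ('X : {poly R[i]}).

(* Main.v *)
(* Working modulo Nbar, e_lambda is a common eigenvector of the Jucys-Murphy
   elements L_m: within a row the eigenvalues follow from
   q L_(m+1) = T_m L_m T_m + T_m, and moving the first node of a row up past a
   row of length r multiplies 1 + (q - 1) L_m by a power of q because of a Garnir
   relation. A Garnir relation holds since the element in question is invariant
   under the row stabilizer of a composition that dominates lambda after sorting,
   hence a multiple of the symmetrizer of that composition, whose square is a
   nonzero multiple of itself.

   Let rho_i be the radial distance from the node of i+1 to (k,l). The
   intertwining relations between T_i, L_i and L_(i+1) show that
   v_d = e_lambda prod_(c <= i < d) (T_i + 1/[rho_i]) is an eigenvector with the
   eigenvalues of t_d. So v_n E_(t_n) = v_n, whereas e_n - v_n is a combination of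
   the v_d T_(d+1) ... T_(n-1), which are killed by the factor L_d - [l - k] of
   E_(t_n). Thus f_n = v_n.

   Along a single row the product telescopes to T_sigma + R_i / [rho], as
   q [m] + 1 = [m+1]. Across two consecutive rows of equal length the
   discrepancy with the recursion for phi is a multiple of
   phi (T_sigma + R_(i+1)); both factors commute, and the second one is the Garnir
   element, which kills e_lambda. *)

Require Import Defs.
From HB Require Import structures.
From mathcomp Require Import all_boot all_order all_algebra all_fingroup.
From mathcomp Require Import complex fraction reals.
From mathcomp Require Import zify.
Set Implicit Arguments.
Unset Strict Implicit.
Unset Printing Implicit Defensive.
Import Order.TTheory GRing.Theory Num.Theory.
Local Open Scope ring_scope.

(** * Length of permutations *)

(** Neither a basis of the Specht module nor semisimplicity is invoked: every claim is the
    membership of an explicit element in the two-sided ideal [Nbar], and of [q] only the properties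
    collected in [generic] enter. Since the row symmetrizer of [la] is the left factor of every
    vector, a congruence for it applies only to an element standing directly to its right; hence the
    many commutations of generators with distant words. Garnir elements are symmetric for
    compositions whose rows need not decrease and may be empty, so membership in [Nbar] is tested on
    compositions. The product [hmul] follows chosen reduced words from the right, so associativity
    is not built in; it comes from the commutation of the left and right actions of generators on
    the basis. For standardness, all words met are strictly increasing, so they slide entries along
    runs of consecutive letters. A condition on where runs start and how far they reach survives
    concatenation and passage to prefixes, and it excludes every wrongly ordered pair of
    neighbours. *)

Section PermLength.
Variable n : nat.
Implicit Types (w : 'S_n) (a b : 'I_n).

Lemma perm_lenV w : perm_len w^-1%g = perm_len w.
Proof.
rewrite /perm_len.
have f_inj : injective (fun p : 'I_n * 'I_n => (w p.2, w p.1)).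
  by move=> [x1 x2] [y1 y2] /= [/perm_inj -> /perm_inj ->].
rewrite -[RHS](card_imset _ f_inj); apply: eq_card => -[x y].
rewrite !inE /=; apply/andP/imsetP => [[lxy lyx]|[[x' y']]].
  exists (w^-1 y, w^-1 x)%g; rewrite /= ?inE /= ?permKV //.
  by rewrite lyx lxy.
by rewrite inE /= => /andP[l1 l2] [-> ->]; rewrite !permK.
Qed.

Lemma perm_len1 : perm_len (1%g : 'S_n) = 0%N.
Proof.
by apply: eq_card0 => -[x y]; rewrite !inE !perm1 /=; case: ltngtP.
Qed.

(** As [a] and [b] are adjacent, the transposition preserves the order of every pair except
    [(a, b)], so it carries the other inversions of one permutation to those of the other. Adding
    booleans on both sides avoids truncated subtraction. *)
Lemma perm_len_tpermM w a b : b = a.+1 :> nat ->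
  (perm_len (tperm a b * w)%g + (w b < w a))%N = (perm_len w + (w a < w b))%N.
Proof.
move=> Eb; set s := tperm a b.
pose I (v : 'S_n) := [set p : 'I_n * 'I_n | (p.1 < p.2)%N && (v p.2 < v p.1)%N].
have ltab : (a < b)%N by rewrite Eb.
rewrite /perm_len -/(I (s * w)%g) -/(I w).
rewrite (cardsD1 (a, b) (I (s * w)%g)) (cardsD1 (a, b) (I w)).
rewrite !inE /= ltab !permM tpermL tpermR /=.
suff -> : #|I (s * w)%g :\ (a, b)| = #|I w :\ (a, b)| by rewrite addnC addnCA addnC.
have f_inj : injective (fun p : 'I_n * 'I_n => (s p.1, s p.2)).
  by move=> [x1 x2] [y1 y2] /= [/perm_inj -> /perm_inj ->].
have ord_s (x y : 'I_n) : (x < y)%N -> (x, y) != (a, b) -> (s x < s y)%N.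
  rewrite xpair_eqE negb_and.
  have neqN (u v : 'I_n) : u <> v -> (u : nat) <> v by move=> ne /val_inj.
  rewrite -!val_eqE /=.
  case: (tpermP a b x) => [->|->|/neqN ? /neqN ?];
  case: (tpermP a b y) => [->|->|/neqN ? /neqN ?] /=; lia.
have ne_s (x y : 'I_n) : (x < y)%N -> (x, y) != (a, b) -> (s x, s y) != (a, b).
  move=> lxy _; apply: contraTneq lxy => -[Ex Ey].
  have -> : x = b by rewrite -[x](tpermK a b) -/s Ex /s tpermL.
  have -> : y = a by rewrite -[y](tpermK a b) -/s Ey /s tpermR.
  by rewrite -leqNgt ltnW.
rewrite -[LHS](card_imset _ f_inj); apply: eq_card => -[x y].
apply/imsetP/idP => [[[x' y']]|].
  rewrite !inE /= !permM => /and3P[ne l1 l2] [-> ->].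
  by rewrite ne_s //= ord_s.
rewrite !inE /= => /and3P[ne l1 l2]; exists (s x, s y); last by rewrite /= !tpermK.
by rewrite !inE /= !permM !tpermK l2 ne_s // ord_s.
Qed.

Lemma perm_len_Mtperm w a b : b = a.+1 :> nat ->
  (perm_len (w * tperm a b)%g + (w^-1%g b < w^-1%g a))%N
    = (perm_len w + (w^-1%g a < w^-1%g b))%N.
Proof.
move=> Eb; rewrite -(perm_lenV w) -perm_len_tpermM //.
by rewrite -(perm_lenV (w * _)) invMg tpermV.
Qed.

Lemma sgen_tperm a b : b = a.+1 :> nat -> sgen n b = tperm a b.
Proof.
move=> Eb; rewrite /sgen /tpermN Eb /= -Eb.
by rewrite !valK.
Qed.

Lemma sgenP i : (0 < i < n)%N ->
  exists a b, [/\ b = a.+1 :> nat, i = b :> nat & sgen n i = tperm a b].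
Proof.
case: i => // i /= lti; exists (Ordinal (ltnW lti)), (Ordinal lti); split=> //.
by rewrite -(@sgen_tperm (Ordinal (ltnW lti)) (Ordinal lti)).
Qed.

Lemma sgenK i : (sgen n i * sgen n i = 1)%g.
Proof.
rewrite /sgen /tpermN.
by case: (insub i.-1 : option 'I_n) => [x|]; case: (insub i : option 'I_n) => [y|]; rewrite ?tperm2 ?mulg1.
Qed.

Lemma sgenV i : ((sgen n i)^-1 = sgen n i)%g.
Proof. by apply/eqP; rewrite eq_invg_mul sgenK. Qed.

(** At [i = 0] the predecessor truncates and both points coincide; for [i >= n] the second point is
    missing. Hence [T i = 1] out of range, which frees commutation lemmas from range hypotheses. *)
Lemma sgen_out i : ~~ (0 < i < n)%N -> sgen n i = 1%g.
Proof.
move=> out; rewrite /sgen /tpermN.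
case: (insubP 'I_n i.-1) => [x _ Ex|//]; case: (insubP 'I_n i) => [y lt Ey|//].
have -> : y = x; last exact: tperm1.
by apply: val_inj; rewrite /= Ex Ey; lia.
Qed.

Lemma sgenE i (x : 'I_n) : (0 < i < n)%N -> sgen n i x =
  (if x == i.-1 :> nat then i else if x == i :> nat then i.-1 else x) :> nat.
Proof.
move=> /sgenP[a [b [Eb -> ->]]]; rewrite Eb /=.
case: tpermP => [->|->|nxa nxb].
- by rewrite eqxx.
- by rewrite Eb eqxx; case: eqP => //; lia.
have xa : x <> a :> nat by move/val_inj.
have xb : x <> b :> nat by move/val_inj.
by rewrite -Eb; move/eqP/negPf: xa => ->; move/eqP/negPf: xb => ->.
Qed.

(** With products composed from left to right, [lasc] compares the values at two adjacent positions,
    [rasc] the positions of two adjacent values. *)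
Definition rasc w i := (perm_len w < perm_len (w * sgen n i)%g)%N.
Definition lasc i w := (perm_len w < perm_len (sgen n i * w)%g)%N.

Lemma len_step (p p' x y : nat) : x <> y ->
  (p' + (y < x) = p + (x < y))%N ->
  (p < p')%N = (x < y)%N /\ p' = if (x < y)%N then p.+1 else p.-1.
Proof. by case: (ltngtP x y) => //= _ _; split; lia. Qed.

Lemma ord_succ_neq a b (f : 'I_n -> 'I_n) : injective f -> b = a.+1 :> nat ->
  f a <> f b :> nat.
Proof. by move=> f_inj Eb /val_inj/f_inj E; move: Eb; rewrite E; lia. Qed.

Lemma lascE w a b : b = a.+1 :> nat -> lasc b w = (w a < w b)%N.
Proof.
move=> Eb; rewrite /lasc (sgen_tperm Eb).
by have [-> _] := len_step (ord_succ_neq (@perm_inj _ w) Eb) (perm_len_tpermM w Eb).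
Qed.

Lemma rascE w a b : b = a.+1 :> nat -> rasc w b = (w^-1%g a < w^-1%g b)%N.
Proof.
move=> Eb; rewrite -lascE // /rasc /lasc perm_lenV.
by rewrite -(perm_lenV (_ * w^-1)) invMg invgK sgenV.
Qed.

Lemma perm_len_rasc w i : (0 < i < n)%N ->
  perm_len (w * sgen n i)%g = if rasc w i then (perm_len w).+1 else (perm_len w).-1.
Proof.
move=> /sgenP[a [b [Eb -> Es]]]; rewrite (rascE _ Eb) Es.
by have [_ ->] := len_step (ord_succ_neq (@perm_inj _ w^-1%g) Eb) (perm_len_Mtperm w Eb).
Qed.

Lemma perm_len_rdesc w i : (0 < i < n)%N -> ~~ rasc w i ->
  perm_len w = (perm_len (w * sgen n i)%g).+1.
Proof.
move=> /sgenP[a [b [Eb -> Es]]]; rewrite (rascE _ Eb) Es => nlt.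
have neq := ord_succ_neq (@perm_inj _ w^-1%g) Eb.
have := perm_len_Mtperm w Eb; rewrite (negPf nlt) addn0 => <-.
by move: nlt; case: ltngtP neq => //=; rewrite addn1.
Qed.

Lemma rasc_Msgen w i : (0 < i < n)%N -> rasc (w * sgen n i)%g i = ~~ rasc w i.
Proof.
move=> lti; have := perm_len_rasc w lti.
rewrite {2}/rasc -mulgA sgenK mulg1; case: ifP => [A|/negbT A].
  by move=> ->; rewrite ltnNge leqnSn.
by move=> _; rewrite [X in (_ < X)%N](perm_len_rdesc lti A) leqnn.
Qed.

Lemma lasc_sgenM w i : (0 < i < n)%N -> lasc i (sgen n i * w)%g = ~~ lasc i w.
Proof.
have lascV v : lasc i v = rasc v^-1%g i.
  by rewrite /lasc /rasc -(perm_lenV v) -(perm_lenV (_ * v)) invMg sgenV.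
by move=> lti; rewrite !lascV invMg sgenV rasc_Msgen.
Qed.

(** Without a right descent the inverse of [w] is increasing, hence so is [w]. An increasing
    self-map of an initial segment lies above the identity, and applying this to both [w] and its
    inverse gives equality. *)
Lemma exists_rdesc w : w != 1%g -> exists2 i, (0 < i < n)%N & ~~ rasc w i.
Proof.
move=> wn1.
have [i /andP[i0 di]|nodesc] := pickP [pred i : 'I_n | (0 < i)%N && ~~ rasc w i].
  by exists (i : nat) => //; rewrite i0; exact: ltn_ord.
suff w1 : w = 1%g by rewrite w1 eqxx in wn1.
have inc (x y : 'I_n) : (x < y)%N -> (w^-1%g x < w^-1%g y)%N.
  move: {2}(y - x.+1)%N (erefl (y - x.+1)%N) => k; elim: k y => [|k IH] y Ek ltxy.
    have Ey : y = x.+1 :> nat by lia.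
    by have /= := nodesc y; rewrite (rascE _ Ey) Ey /= => /negbFE.
  have lt' : (y.-1 < n)%N by have := ltn_ord y; lia.
  have Ey : y = (Ordinal lt').+1 :> nat by rewrite /=; lia.
  apply: ltn_trans (IH (Ordinal lt') _ _) _; rewrite /=; try lia.
  by have /= := nodesc y; rewrite (rascE _ Ey) (_ : 0 < y)%N /=; [move=> /negbFE|lia].
have le_id (v : 'S_n) : (forall x y : 'I_n, (x < y)%N -> (v x < v y)%N) -> forall x : 'I_n, (x <= v x)%N.
  move=> vinc [x ltx] /=; elim: x ltx => // x IH ltx.
  by apply: leq_ltn_trans (IH (ltnW ltx)) _; apply: vinc => /=.
apply/permP => x; rewrite perm1; apply: val_inj; apply/eqP; rewrite eqn_leq /=.
have inc' (u v : 'I_n) : (u < v)%N -> (w u < w v)%N.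
  rewrite !ltnNge; apply: contra.
  rewrite leq_eqVlt => /orP[/eqP/val_inj/perm_inj->|/inc]; rewrite ?leqnn ?permK; first by []; exact: ltnW.
by rewrite (le_id w inc') andbT -{2}(permK w x) (le_id w^-1%g inc).
Qed.

End PermLength.

(** * The Hecke algebra *)

(* [hecke K n] carries no algebra structure since its product depends on [q]. *)
Definition heckeAlg (K : fieldType) (q : K) (n : nat) : Type := hecke K n.

HB.instance Definition _ (K : fieldType) (q : K) (n : nat) :=
  GRing.Zmodule.copy (heckeAlg q n) {ffun 'S_n -> K}.

Section HeckeLmodule.
Variables (K : fieldType) (q : K) (n : nat).
Local Notation H := (heckeAlg q n).

Fact hscaleA (a b : K) (h : H) : hscale a (hscale b h) = hscale (a * b) h.
Proof. by apply/ffunP => w; rewrite !ffunE mulrA. Qed.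
Fact hscale1 : left_id 1 (@hscale K n : K -> H -> H).
Proof. by move=> h; apply/ffunP => w; rewrite !ffunE mul1r. Qed.
Fact hscaleDr : right_distributive (@hscale K n : K -> H -> H) +%R.
Proof. by move=> a g h; apply/ffunP => w; rewrite !ffunE mulrDr. Qed.
Fact hscaleDl (h : H) : {morph (fun a => hscale a h : H) : a b / a + b}.
Proof. by move=> a b; apply/ffunP => w; rewrite !ffunE mulrDl. Qed.

HB.instance Definition _ := GRing.Zmodule_isLmodule.Build K H
  hscaleA hscale1 hscaleDr hscaleDl.

Definition basisT (w : 'S_n) : H := Tw K w.
Local Notation TT := basisT.

Lemma heckeE (h : H) : h = \sum_w h w *: TT w.
Proof.
apply/ffunP => x; rewrite sum_ffunE (bigD1 x) //= big1 ?addr0 => [|w ne].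
  by rewrite !ffunE eqxx mulr1.
by rewrite !ffunE eq_sym (negPf ne) mulr0.
Qed.

Lemma linear_basis (g : 'S_n -> H) : linear (fun h : H => \sum_w h w *: g w).
Proof.
move=> a x y; rewrite scaler_sumr -big_split /=; apply: eq_bigr => w _.
by rewrite !ffunE scalerDl scalerA.
Qed.

Lemma sum_basisT (g : 'S_n -> H) x : \sum_w (TT x) w *: g w = g x.
Proof.
rewrite (bigD1 x) //= big1 ?addr0 => [|w ne]; rewrite ffunE ?eqxx ?scale1r //.
by rewrite (negPf ne) scale0r.
Qed.

Lemma linear_heckeZ (f : H -> H) : linear f -> forall a h, f (a *: h) = a *: f h.
Proof.
move=> lf a h; pose F : {linear H -> H} := HB.pack f (GRing.isLinear.Build K H H *:%R f lf).
exact: (linearZ_LR F a h).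
Qed.

Lemma linear_heckeE (f : H -> H) : linear f -> forall h, f h = \sum_w h w *: f (TT w).
Proof.
move=> lf h; pose F : {linear H -> H} := HB.pack f (GRing.isLinear.Build K H H *:%R f lf).
rewrite [LHS](_ : _ = F (\sum_w h w *: TT w)); last by rewrite -heckeE.
by rewrite raddf_sum; apply: eq_bigr => w _; exact: (linearZ_LR F (h w) (TT w)).
Qed.

Lemma linear_hecke_ext (f g : H -> H) : linear f -> linear g ->
  (forall w, f (TT w) = g (TT w)) -> f =1 g.
Proof.
move=> lf lg E h; rewrite (linear_heckeE lf) (linear_heckeE lg).
by apply: eq_bigr => w _; rewrite E.
Qed.

Lemma linear_comp (f g : H -> H) : linear f -> linear g -> linear (f \o g).
Proof. by move=> lf lg a x y; rewrite /= lg lf. Qed.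

Definition rT (i : nat) (h : H) : H := rmulTs q h (sgen n i).
(** Mirror image of [rT]. Since [hmul] is built from right actions alone, the left action is
    introduced separately and shown to commute with the right one. *)
Definition lT (i : nat) (h : H) : H :=
  \sum_w h w *: (if lasc i w then TT (sgen n i * w)%g
                 else q *: TT (sgen n i * w)%g + (q - 1) *: TT w).

Lemma rT_lin i : linear (rT i).
Proof. exact: linear_basis. Qed.
Lemma lT_lin i : linear (lT i).
Proof. exact: linear_basis. Qed.

Lemma rT_T i w : rT i (TT w) = if rasc w i then TT (w * sgen n i)%g
  else q *: TT (w * sgen n i)%g + (q - 1) *: TT w.
Proof. exact: sum_basisT. Qed.
Lemma lT_T i w : lT i (TT w) = if lasc i w then TT (sgen n i * w)%g
  else q *: TT (sgen n i * w)%g + (q - 1) *: TT w.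
Proof. exact: sum_basisT. Qed.

(** Left multiplication by [s] can change whether [t] is a right ascent of [w] only if [s w = w t].
    In that case both actions agree on the span of [w] and [s w]; otherwise left and right ascents
    are independent and the four cases match term by term. *)
Lemma lT_rT i j h : (0 < i < n)%N -> (0 < j < n)%N -> lT i (rT j h) = rT j (lT i h).
Proof.
move=> lti ltj; apply: (linear_hecke_ext (f := lT i \o rT j) (g := rT j \o lT i)).
- exact: linear_comp (lT_lin i) (rT_lin j).
- exact: linear_comp (rT_lin j) (lT_lin i).
move=> w /=; pose s := sgen n i; pose t := sgen n j.
have lTD x y : lT i (q *: x + y) = q *: lT i x + lT i y by exact: lT_lin.
have rTD x y : rT j (q *: x + y) = q *: rT j x + rT j y by exact: rT_lin.
have lTZ a x : lT i (a *: x) = a *: lT i x by exact: linear_heckeZ (lT_lin i) a x.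
have rTZ a x : rT j (a *: x) = a *: rT j x by exact: linear_heckeZ (rT_lin j) a x.
have [E|NE] := eqVneq (s * w)%g (w * t)%g.
  have stw : (s * (w * t) = w)%g by rewrite -E mulgA sgenK mul1g.
  have swt : (s * w * t = w)%g by rewrite E -mulgA sgenK mulg1.
  have A : rasc w j = lasc i w by rewrite /rasc /lasc -/s -/t E.
  have B : rasc (s * w)%g j = ~~ lasc i w by rewrite E rasc_Msgen // A.
  have C : lasc i (w * t)%g = ~~ lasc i w by rewrite -E lasc_sgenM.
  rewrite rT_T lT_T A; case: (boolP (lasc i w)) => D.
    by rewrite lT_T rT_T C B D /= stw swt E.
  by rewrite lTD rTD lTZ rTZ !lT_T !rT_T C B (negPf D) A (negPf D) /= stw swt E.
have [a [b [Eb Ei Es]]] := sgenP lti; have [c [d [Ed Ej Et]]] := sgenP ltj.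
(* Conjugating a transposition by [w] transposes the images, so this only restates that [s w] and
   [w t] differ. *)
have NE' : ~ ((w a = c /\ w b = d) \/ (w a = d /\ w b = c)).
  case=> -[E1 E2]; case/eqP: NE; rewrite /s /t Es Et; apply/permP => x.
    have := tpermJ a b w; rewrite E1 E2 /conjg => <-.
    by rewrite !mulgA mulgV mul1g.
  have := tpermJ a b w; rewrite E1 E2 /conjg (tpermC c) => <-.
  by rewrite !mulgA mulgV mul1g.
have A : lasc i (w * t)%g = lasc i w.
  rewrite Ei !(lascE _ Eb) !permM /t Et.
  have neqN (u v : 'I_n) : u <> v -> (u : nat) <> v by move=> ne /val_inj.
  have ne : (w a : nat) <> w b by apply: neqN => /perm_inj Eab; move: Eb; rewrite Eab; lia.
  case: (tpermP c d (w a)) => [E1|E1|/neqN ? /neqN ?];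
  case: (tpermP c d (w b)) => [E2|E2|/neqN ? /neqN ?] /=; rewrite ?E1 ?E2 in ne *; try lia.
  + by case: NE'; left.
  + by case: NE'; right.
have B : rasc (s * w)%g j = rasc w j.
  rewrite Ej !(rascE _ Ed) invMg !permM /s sgenV Es.
  have neqN (u v : 'I_n) : u <> v -> (u : nat) <> v by move=> ne /val_inj.
  have ne : (w^-1%g c : nat) <> w^-1%g d.
    by apply: neqN => /perm_inj Eab; move: Ed; rewrite Eab; lia.
  case: (tpermP a b (w^-1%g c)) => [E1|E1|/neqN ? /neqN ?];
  case: (tpermP a b (w^-1%g d)) => [E2|E2|/neqN ? /neqN ?] /=; rewrite ?E1 ?E2 in ne *; try lia.
  + by case: NE'; left; rewrite -E1 -E2 !permKV.
  + by case: NE'; right; rewrite -E1 -E2 !permKV.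
have M : (s * (w * t) = s * w * t)%g by rewrite mulgA.
rewrite rT_T lT_T; case: (boolP (rasc w j)) => Dj; case: (boolP (lasc i w)) => Di;
  rewrite ?lTD ?rTD ?lTZ ?rTZ !lT_T !rT_T -/s -/t ?A ?B ?Dj ?Di ?(negPf Dj) ?(negPf Di) ?M //.
rewrite !scalerDr !scalerA !addrA; congr (_ + _).
by rewrite addrAC (mulrC q (q - 1)).
Qed.

End HeckeLmodule.

(** * Associativity of the product and the algebra structure *)

Section HeckeRing.
Variables (K : fieldType) (q : K) (n : nat).
Local Notation H := (heckeAlg q n).
Local Notation TT := (@basisT K q n).
Implicit Types (w : 'S_n) (h : H).

Fixpoint lTs (s : seq nat) (h : H) : H := if s is i :: s' then lT i (lTs s' h) else h.

Definition in_range (s : seq nat) := all (fun i => (0 < i < n)%N) s.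

Lemma lTs_lin s : linear (lTs s).
Proof. by elim: s => [|i s IH] // a x y; rewrite /= IH lT_lin. Qed.

Lemma rmulT_fuel_lin f w : linear (fun h : H => rmulT_fuel q f h w : H).
Proof.
elim: f w => [|f IH] w // a x y /=; case: pickP => [i _|_] //.
by rewrite IH -!/(rT i _) rT_lin.
Qed.

Lemma lTs_rmulT_fuel s f h w : in_range s ->
  lTs s (rmulT_fuel q f h w) = rmulT_fuel q f (lTs s h) w.
Proof.
have lTs1 i g j : (0 < i < n)%N -> in_range j -> lTs j (rT i g) = rT i (lTs j g).
  by move=> lti; elim: j => // k j IH /= /andP[ltk rj]; rewrite IH // lT_rT.
move=> rs; elim: f w => [|f IH] w //=; case: pickP => [i /andP[i0 _]|_] //.
by rewrite lTs1 ?IH // i0 ltn_ord.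
Qed.

Lemma lTs_rmulT s h w : in_range s -> lTs s (rmulT q h w) = rmulT q (lTs s h) w.
Proof. exact: lTs_rmulT_fuel. Qed.

(** The fuel equals the length, so a right descent is available at every step and the recursion
    stops exactly at the identity. *)
Lemma rmulT1 w : rmulT q (TT 1) w = TT w.
Proof.
suff fuel f : f = perm_len w -> rmulT_fuel q f (TT 1) w = TT w by exact: fuel.
elim: f w => [|f IH] w Ef /=.
  have [->//|/exists_rdesc[i lti /(perm_len_rdesc lti)]] := eqVneq w 1%g.
  by rewrite -Ef.
case: pickP => [i /andP[i0 di]|nodesc].
  have lti : (0 < i < n)%N by rewrite i0 ltn_ord.
  have ni : ~~ rasc w i by rewrite /rasc -leqNgt ltnW.
  have Ew := perm_len_rdesc lti ni; rewrite -Ef in Ew; case: Ew => Ew.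
  rewrite IH // -/(rT i _) rT_T rasc_Msgen // ni.
  by rewrite -mulgA sgenK mulg1.
have [w1|/exists_rdesc[i lti ni]] := eqVneq w 1%g.
  by move: Ef; rewrite w1 perm_len1.
have [_ ltin] := andP lti; have := nodesc (Ordinal ltin) => /=.
by rewrite (perm_len_rdesc lti ni) leqnn; case/andP: lti => ->.
Qed.

(** Left descents are stripped one by one; they are the right descents of the inverse. *)
Lemma TT_word w : exists2 s, in_range s & TT w = lTs s (TT 1).
Proof.
move: {2}(perm_len w) (erefl (perm_len w)) => f; elim: f w => [|f IH] w Ef.
  have [->|/exists_rdesc[i lti /(perm_len_rdesc lti)]] := eqVneq w 1%g; first by exists [::].
  by rewrite Ef.
have [w1|] := eqVneq w 1%g; first by move: Ef; rewrite w1 perm_len1.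
rewrite -invg_eq1 => /exists_rdesc[i lti ni].
have := perm_len_rdesc lti ni; rewrite perm_lenV Ef -perm_lenV invMg invgK sgenV.
case=> /esym/IH[s rs Es]; exists (i :: s); first by rewrite /= lti.
rewrite /= -Es lT_T lasc_sgenM // (_ : lasc i w = rasc w^-1%g i).
  by rewrite ni mulgA sgenK mul1g.
by rewrite /lasc /rasc -(perm_lenV (_ * w)) -(perm_lenV w) invMg sgenV.
Qed.

Lemma hmulEr (a b : H) : hmul q a b = \sum_w b w *: (rmulT q a w : H).
Proof. by []. Qed.

Lemma hmul_linl b : linear (fun a : H => hmul q a b : H).
Proof.
move=> c x y; rewrite !hmulEr scaler_sumr -big_split /=; apply: eq_bigr => w _.
by rewrite /rmulT rmulT_fuel_lin scalerDr !scalerA mulrC.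
Qed.

Lemma hmul_linr a : linear (fun b : H => hmul q a b : H).
Proof. exact: linear_basis. Qed.

Lemma hmul1l : left_id (hone K n : H) (@hmul K q n : H -> H -> H).
Proof.
move=> b; rewrite hmulEr [RHS]heckeE; apply: eq_bigr => w _.
by rewrite rmulT1.
Qed.

Lemma hmul_lTs s (a b : H) : in_range s -> hmul q (lTs s a) b = lTs s (hmul q a b) :> H.
Proof.
move=> rs; rewrite !hmulEr.
have lf := lTs_lin s.
pose F : {linear H -> H} := HB.pack (lTs s) (GRing.isLinear.Build K H H *:%R _ lf).
rewrite [RHS](raddf_sum F); apply: eq_bigr => w _.
by rewrite -lTs_rmulT //; exact/esym/(linear_heckeZ lf).
Qed.

(** By linearity [a] may be a basis vector, that is, a word of left operators applied to the unit.
    These operators pull out of products, so only the case of the unit remains. *)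
Lemma hmulA : associative (@hmul K q n : H -> H -> H).
Proof.
move=> a b c; apply: (linear_hecke_ext (f := fun a => hmul q a (hmul q b c))
  (g := fun a => hmul q (hmul q a b) c)).
- exact: hmul_linl.
- exact: linear_comp (hmul_linl c) (hmul_linl b).
move=> w /=; have [s rs ->] := TT_word w.
by rewrite !hmul_lTs // !hmul1l.
Qed.

Lemma hmulT a w : hmul q a (TT w) = rmulT q a w.
Proof. exact: sum_basisT. Qed.

Lemma hmul1r : right_id (hone K n : H) (@hmul K q n : H -> H -> H).
Proof. by move=> a; rewrite [LHS]hmulT /rmulT perm_len1. Qed.

Lemma hmulDl : left_distributive (@hmul K q n : H -> H -> H) +%R.
Proof. by move=> a b c; have := hmul_linl c 1 a b; rewrite !scale1r. Qed.
Lemma hmulDr : right_distributive (@hmul K q n : H -> H -> H) +%R.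
Proof. by move=> a b c; have := hmul_linr a 1 b c; rewrite !scale1r. Qed.
Lemma hone_neq0 : (hone K n : H) != 0.
Proof.
apply/eqP => /ffunP/(_ 1%g); rewrite !ffunE eqxx => /eqP; exact/negP/oner_neq0.
Qed.

(* Locked, lest unification unfold products into the sums defining [hmul]. *)
Fact hecke_mul_key : unit. Proof. exact: tt. Qed.
Definition hecke_mul : H -> H -> H := locked_with hecke_mul_key (@hmul K q n).
Fact hecke_mulE : hecke_mul = @hmul K q n.
Proof. by rewrite /hecke_mul unlock. Qed.

Fact hecke_mulA : associative hecke_mul.
Proof. by rewrite hecke_mulE; exact: hmulA. Qed.
Fact hecke_mul1l : left_id (hone K n : H) hecke_mul.
Proof. by rewrite hecke_mulE; exact: hmul1l. Qed.
Fact hecke_mul1r : right_id (hone K n : H) hecke_mul.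
Proof. by rewrite hecke_mulE; exact: hmul1r. Qed.
Fact hecke_mulDl : left_distributive hecke_mul +%R.
Proof. by rewrite hecke_mulE; exact: hmulDl. Qed.
Fact hecke_mulDr : right_distributive hecke_mul +%R.
Proof. by rewrite hecke_mulE; exact: hmulDr. Qed.

HB.instance Definition _ := GRing.Zmodule_isNzRing.Build H
  hecke_mulA hecke_mul1l hecke_mul1r hecke_mulDl hecke_mulDr hone_neq0.

Lemma mulHE (x y : H) : x * y = hmul q x y.
Proof. by rewrite -[LHS]/(hecke_mul x y) hecke_mulE. Qed.

Fact hscaleAl (a : K) (x y : H) : a *: (x * y) = a *: x * y.
Proof. by rewrite !mulHE [RHS](linear_heckeZ (hmul_linl y)). Qed.
Fact hscaleAr (a : K) (x y : H) : a *: (x * y) = x * (a *: y).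
Proof. by rewrite !mulHE [RHS](linear_heckeZ (hmul_linr x)). Qed.

HB.instance Definition _ := GRing.Lmodule_isLalgebra.Build K H hscaleAl.
HB.instance Definition _ := GRing.Lalgebra_isAlgebra.Build K H hscaleAr.

Definition genT (i : nat) : H := TT (sgen n i).
Local Notation T := genT.

Lemma TT1 : TT 1 = 1.
Proof. by []. Qed.

End HeckeRing.

(** * Defining relations, cycles and the recursion for Jucys-Murphy elements *)

Section HeckeRelations.
Variables (K : fieldType) (q : K) (n : nat).
Local Notation H := (heckeAlg q n).
Local Notation TT := (@basisT K q n).
Local Notation T := (@genT K q n).
Implicit Types (w : 'S_n) (h : H).

Lemma perm_len_sgen i : (0 < i < n)%N -> perm_len (sgen n i) = 1%N.
Proof.
move=> lti; have := perm_len_rasc 1%g lti; rewrite mul1g perm_len1 ifT //.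
by have [a [b [Eb -> _]]] := sgenP lti; rewrite (rascE _ Eb) invg1 !perm1 Eb.
Qed.

Lemma TT_T w i : (0 < i < n)%N -> TT w * T i =
  if rasc w i then TT (w * sgen n i)%g else q *: TT (w * sgen n i)%g + (q - 1) *: TT w.
Proof.
move=> lti; rewrite -rT_T mulHE [LHS]hmulT /rmulT.
have len1 := perm_len_sgen lti.
rewrite len1 /=; case: pickP => [j /andP[j0]|nodesc].
  (* The index returned by [pick] need not be syntactically [i], but a product of two generators of
     length below 1 is the identity, so both give the same transposition. *)
  rewrite len1 => lj; have ltj : (0 < j < n)%N by rewrite j0 ltn_ord.
  suff -> : sgen n j = sgen n i by [].
  apply/eqP; rewrite -(inj_eq (mulgI (sgen n i))) sgenK; apply: contraLR lj.
  by move=> /exists_rdesc[k ltk /(perm_len_rdesc ltk) ->].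
have [_ ltin] := andP lti; have := nodesc (Ordinal ltin) => /=.
by case/andP: lti => ->; rewrite sgenK perm_len1 len1.
Qed.

Lemma T_TT w i : (0 < i < n)%N -> T i * TT w =
  if lasc i w then TT (sgen n i * w)%g else q *: TT (sgen n i * w)%g + (q - 1) *: TT w.
Proof.
move=> lti; rewrite -lT_T.
have -> : T i = lT i 1.
  rewrite -TT1 lT_T mulg1 ifT // /lasc mulg1 perm_len1 perm_len_sgen //.
have ri : in_range n [:: i] by rewrite /= lti.
by rewrite mulHE [LHS](hmul_lTs 1 (TT w) ri) [hmul _ _ _]hmul1l.
Qed.

Lemma T_out i : ~~ (0 < i < n)%N -> T i = 1.
Proof. by move=> out; rewrite /genT sgen_out. Qed.

Lemma TT_sgen w i : (0 < i < n)%N -> rasc w i -> TT (w * sgen n i)%g = TT w * T i.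
Proof. by move=> lti A; rewrite TT_T // A. Qed.

Lemma T_quad i : (0 < i < n)%N -> T i * T i = (q - 1) *: T i + q *: 1.
Proof.
move=> lti; rewrite [LHS](TT_T _ lti) sgenK.
have := rasc_Msgen 1%g lti; rewrite mul1g => ->; rewrite addrC.
suff -> : rasc (1%g : 'S_n) i by [].
have [a [b [Eb -> _]]] := sgenP lti.
by rewrite (rascE _ Eb) invg1 !perm1 Eb.
Qed.

(** Here [s_b w = w s_d], with lengths adding on both sides. Far commutation, the braid relation and
    the interchange of two rows are all instances. *)
Lemma T_TT_conj w (a b c d : 'I_n) : b = a.+1 :> nat -> d = c.+1 :> nat ->
  w a = c -> w b = d -> T b * TT w = TT w * T d.
Proof.
move=> Eb Ed wa wb.
have ltb : (0 < b < n)%N by rewrite ltn_ord andbT Eb.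
have ltd : (0 < d < n)%N by rewrite ltn_ord andbT Ed.
rewrite T_TT // TT_T // (lascE _ Eb) (rascE _ Ed) wa wb -wa -wb !permK wa wb Eb Ed !ltnSn.
congr (TT _); rewrite -Eb -Ed (sgen_tperm Eb) (sgen_tperm Ed) -wa -wb.
by rewrite -tpermJ /conjg !mulgA mulgV mul1g.
Qed.

Lemma T_comm i j : (i.+1 < j)%N -> T i * T j = T j * T i.
Proof.
move=> lij.
case: (boolP (0 < i < n)%N) => lti; last by rewrite (T_out lti) mul1r mulr1.
case: (boolP (0 < j < n)%N) => ltj; last by rewrite (T_out ltj) mul1r mulr1.
have [a [b [Eb Ej _]]] := sgenP ltj; rewrite Ej.
symmetry; apply: (@T_TT_conj (sgen n i) a b a b) => //; apply: val_inj; rewrite /= sgenE //;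
do 2 (case: eqP; first lia); lia.
Qed.

Lemma T_braid i : (0 < i)%N -> (i.+1 < n)%N ->
  T i * T i.+1 * T i = T i.+1 * T i * T i.+1.
Proof.
move=> i0 lti.
have ltiS : (0 < i.+1 < n)%N by [].
have lti' : (0 < i < n)%N by rewrite i0 ltnW.
have [c [d [Ed Ei Es]]] := sgenP lti'; have [d' [b [Eb EiS EsS]]] := sgenP ltiS.
have Ed' : d' = d by apply: val_inj => /=; lia.
rewrite {}Ed' in Eb EsS *.
have A : rasc (sgen n i) i.+1.
  by rewrite EiS (rascE _ Eb) sgenV Es tpermR tpermD -?val_eqE /=; lia.
rewrite -[T i * T i.+1](TT_sgen _ A) // -[T i.+1 * T i * _]mulrA.
rewrite -[T i * T i.+1](TT_sgen _ A) // EiS {2}Ei.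
(* The braid relation is read as [T (i+1)] passing through the basis element of [s_i s_(i+1)] and
   coming out as [T i]. *)
symmetry; apply: (@T_TT_conj _ d b c d) => //; rewrite -?EiS Es EsS permM.
  by rewrite tpermR tpermD // -val_eqE /=; lia.
by rewrite (tpermD (x := c)) -?val_eqE ?tpermR //=; lia.
Qed.

Lemma T_rinv i : q != 0 -> exists v, T i * v = 1.
Proof.
move=> q0; case: (boolP (0 < i < n)%N) => lti; last by exists 1; rewrite T_out ?mulr1.
exists (q^-1 *: (T i - (q - 1) *: 1)).
by rewrite -scalerAr mulrBr -scalerAr mulr1 T_quad // addrAC subrr add0r scalerA mulVf // scale1r.
Qed.

Lemma TT_rinv w : q != 0 -> exists v, TT w * v = 1.
Proof.
move=> q0; have [s + ->] := TT_word q w.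
elim: s => [_|i s IH /= /andP[lti /IH[v Ev]]]; first by exists 1; rewrite mulr1.
have [u Eu] := T_rinv i q0; exists (v * u).
have ri : in_range n [:: i] by rewrite /= lti.
have -> : lT i (lTs s (TT 1)) = T i * lTs s (TT 1).
  rewrite -[lTs s _ in LHS]mul1r mulHE -[lT i _](hmul_lTs 1 _ ri) -mulHE /= -TT1 lT_T mulg1.
  rewrite ifT ?mul1r // /lasc mulg1 perm_len1 perm_len_sgen //.
by rewrite mulrA -(mulrA (T i)) Ev mulr1.
Qed.

Lemma sig_fix i j (x : 'I_n) : (0 < i)%N -> (j <= x)%N -> sig n i j x = x.
Proof.
move=> i0; rewrite /sig; elim: j => [|j IH] ltx; first by rewrite big_geq ?perm1.
have [lij|ltji] := leqP i j; last by rewrite big_geq ?perm1.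
rewrite big_nat_recr //= permM IH ?(ltnW ltx) //.
case: (boolP (0 < j < n)%N) => ltj; last by rewrite (sgen_out ltj) perm1.
by apply: val_inj; rewrite /= sgenE //; do 2 (case: eqP; first lia).
Qed.

(** Ordinals are zero-based: entry [m] is the ordinal [m - 1]. So the cycle carries entry [i] to
    [j], while [sig_mid] lowers the entries [i+1] to [j] by one. *)
Lemma sig_start i j (x : 'I_n) : (0 < i <= j)%N -> x = i.-1 :> nat -> (j <= n)%N ->
  sig n i j x = j.-1 :> nat.
Proof.
move=> /andP[i0]; rewrite /sig; elim: j => [|j IH] lij Ex ltjn; first by lia.
move: lij; rewrite leq_eqVlt => /orP[/eqP<-|lij]; first by rewrite big_geq ?perm1.
rewrite big_nat_recr //= permM sgenE ?IH ?eqxx //; lia.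
Qed.

Lemma sig_mid i j (x : 'I_n) : (0 < i)%N -> (i <= x < j)%N -> (j <= n)%N ->
  sig n i j x = x.-1 :> nat.
Proof.
move=> i0; rewrite /sig; elim: j => [|j IH] /andP[lix ltxj] lejn //.
have lij : (i <= j)%N by rewrite (leq_trans lix).
rewrite big_nat_recr //= permM.
move: ltxj; rewrite ltnS leq_eqVlt => /orP[/eqP Ex|ltxj].
  have -> : (\prod_(i <= m < j) sgen n m)%g x = x by apply: sig_fix; rewrite ?Ex.
  by rewrite sgenE; [rewrite Ex eqxx; case: eqP => //; lia|lia].
rewrite sgenE; last lia.
rewrite IH; [|by rewrite lix|exact: ltnW].
by case: eqP => [|_]; [lia|case: eqP => //; lia].
Qed.

Lemma sig_low i j (x : 'I_n) : (x.+1 < i)%N -> sig n i j x = x.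
Proof.
move=> ltxi; rewrite /sig; elim: j => [|j IH]; first by rewrite big_geq ?perm1.
have [lij|ltji] := leqP i j; last by rewrite big_geq ?perm1.
rewrite big_nat_recr //= permM IH.
case: (boolP (0 < j < n)%N) => ltj; last by rewrite (sgen_out ltj) perm1.
by apply: val_inj; rewrite /= sgenE //; do 2 (case: eqP; first lia).
Qed.

Lemma TT_sig i j : (0 < i)%N -> (j <= n)%N -> TT (sig n i j) = \prod_(i <= m < j) T m.
Proof.
move=> i0; elim: j => [|j IH] lejn; first by rewrite /sig !big_geq.
have [lij|ltji] := leqP i j; last by rewrite /sig !big_geq.
rewrite [RHS]big_nat_recr //= -IH ?(ltnW lejn) // /sig big_nat_recr //=.
have ltj : (0 < j < n)%N by lia.
(* The word stays reduced: before the last letter, the ordinal [j] is still fixed, whereas [j - 1]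
   is the image of [i - 1], so the two are in increasing order. *)
rewrite TT_sgen //; have [a [b [Eb Ej _]]] := sgenP ltj.
rewrite {2}Ej (rascE _ Eb) -/(sig n i j).
have -> : (sig n i j)^-1%g b = b.
  by apply: (@perm_inj _ (sig n i j)); rewrite permKV sig_fix // Ej.
have lti' : (i.-1 < n)%N by lia.
have -> : (sig n i j)^-1%g a = Ordinal lti'; last by rewrite /=; lia.
apply: (@perm_inj _ (sig n i j)); rewrite permKV; apply: val_inj => /=.
by rewrite (@sig_start i j) //=; lia.
Qed.

Definition jucys_murphy (m : nat) : H := Lm q n m.
Local Notation Lq := jucys_murphy.

Lemma Lq1 : Lq 1 = 0.
Proof. by rewrite /jucys_murphy /Lm big_geq. Qed.

Lemma T_TT_tperm_T m (x b c : 'I_n) : c = b.+1 :> nat -> m = c :> nat -> (x < b)%N ->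
  T m * TT (tperm x b) * T m = TT (tperm x c).
Proof.
move=> Ec -> ltx; have ltm : (0 < c < n)%N by rewrite ltn_ord andbT Ec.
rewrite T_TT // (lascE _ Ec) tpermR tpermD -?val_eqE /=; try lia.
rewrite ifT; last lia.
rewrite TT_T // (rascE _ Ec) invMg tpermV sgenV.
rewrite (sgen_tperm Ec) !permM tpermR (tpermD (z := c)) -?val_eqE /=; try lia.
rewrite tpermR tpermD -?val_eqE /=; try lia.
rewrite ltx; congr (TT _).
have := tpermJ x b (tperm b c); rewrite /conjg tpermV mulgA => ->.
by rewrite tpermL tpermD // -val_eqE /=; lia.
Qed.

Lemma tpermN_ord (x y : 'I_n) : tpermN n x y = tperm x y.
Proof. by rewrite /tpermN !valK. Qed.

(** Conjugation by [s_m] turns the transposition [(x, m)] into [(x, m+1)] with lengths adding, so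
    each summand of [L_m] yields one of [L_(m+1)]. The one left over is [T_m]. *)
Lemma LqS m : (0 < m < n)%N -> q != 0 ->
  Lq m.+1 = q^-1 *: (T m * Lq m * T m + T m).
Proof.
move=> ltm q0; rewrite /jucys_murphy /Lm big_ltn ?ltnS; last by case/andP: ltm.
rewrite addrC scalerDr; congr (_ + _); last first.
  by rewrite expr1 subSS subn0 /= -/(sgen n m).
rewrite big_add1 /= mulr_sumr mulr_suml scaler_sumr; apply: eq_big_nat => i /andP[i0 lti].
have [b [c [Ec Em _]]] := sgenP ltm.
have ltx : ((m - i).-1 < n)%N by lia.
have -> : tpermN n (m.+1 - i.+1).-1 m = tperm (Ordinal ltx) c.
  by rewrite -(tpermN_ord (Ordinal ltx) c) subSS /= -Em.
have -> : tpermN n (m - i).-1 m.-1 = tperm (Ordinal ltx) b.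
  by rewrite -(tpermN_ord (Ordinal ltx) b) /=; congr (tpermN _ _ _); rewrite Em Ec.
change (q ^- i.+1 *: TT (tperm (Ordinal ltx) c) =
  q^-1 *: (T m * (q ^- i *: TT (tperm (Ordinal ltx) b)) * T m)).
rewrite -(@T_TT_tperm_T m _ b) //; last by rewrite /=; lia.
by rewrite -scalerAr -scalerAl scalerA -invfM -exprS.
Qed.

End HeckeRelations.

(** * Jucys-Murphy elements *)

(* [U 0, U 1, ...] stands for [T_b, T_(b+1), ...] or for [T_b, T_(b-1), ...]. *)
Section Ladder.
Variables (K : fieldType) (q : K) (A : algType K) (U : nat -> A) (L : nat) (h : A).
Hypothesis U_quad : forall i, (i < L)%N -> U i * U i = (q - 1) *: U i + q *: 1.
Hypothesis U_braid : forall i, (i.+1 < L)%N -> U i * U i.+1 * U i = U i.+1 * U i * U i.+1.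
Hypothesis U_comm : forall i j, (i.+1 < j)%N -> (j < L)%N -> U i * U j = U j * U i.
Hypothesis hU : forall i, (0 < i < L)%N -> h * U i = q *: h.

Local Notation P x := (\prod_(0 <= k < x) U k).

Lemma ladder_comm x i : (x < i)%N -> (i < L)%N -> P x * U i = U i * P x.
Proof.
elim: x => [|x IH] ltxi ltiL; first by rewrite big_geq // mul1r mulr1.
by rewrite big_nat_recr //= -mulrA U_comm // mulrA IH ?mulrA // ltnW.
Qed.

Lemma ladder_shift x i : (i.+1 < x)%N -> (x <= L)%N -> P x * U i = U i.+1 * P x.
Proof.
elim: x => // x IH; rewrite ltnS leq_eqVlt => /orP[/eqP Ex|ltix] lexL.
  rewrite -Ex in lexL *; rewrite !big_nat_recr //= -!mulrA (mulrA (U i)) U_braid //.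
  by rewrite !mulrA ladder_comm.
by rewrite big_nat_recr //= -mulrA -U_comm // mulrA IH ?mulrA // ltnW.
Qed.

Lemma ladder_low x i : (i.+1 < x)%N -> (x <= L)%N -> h * P x * U i = q *: (h * P x).
Proof.
move=> ltix lexL; rewrite -mulrA ladder_shift // mulrA hU ?scalerAl //=.
exact: leq_trans ltix lexL.
Qed.

Lemma ladder_top i : (i < L)%N -> h * P i.+1 * U i = (q - 1) *: (h * P i.+1) + q *: (h * P i).
Proof.
move=> ltiL; rewrite big_nat_recr //= -!mulrA U_quad // !mulrDr.
by rewrite -!scalerAr mulr1.
Qed.

(** The [P x] are shortest coset representatives for adjoining [U 0] to the generators that [h]
    absorbs. Every term other than [i] and [i+1] lets [U i] through to [h]; those two are exchanged
    by means of the quadratic relation. *)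
Lemma ladder_sum i : (i < L)%N ->
  h * (\sum_(0 <= x < L.+1) P x) * U i = q *: (h * \sum_(0 <= x < L.+1) P x).
Proof.
move=> ltiL; rewrite mulr_sumr mulr_suml scaler_sumr.
have split_sum (F : nat -> A) : \sum_(0 <= x < L.+1) F x =
    \sum_(0 <= x < i) F x + (F i + F i.+1 + \sum_(i.+2 <= x < L.+1) F x).
  rewrite (big_cat_nat (n := i)) //=; last by rewrite ltnW // ltnW.
  rewrite (big_ltn (ltnW ltiL : (i < L.+1)%N)) (big_ltn (m := i.+1)) //.
  by rewrite [F i + (_ + _)]addrA.
rewrite !{}split_sum; congr (_ + (_ + _)).
- apply: eq_big_nat => x /andP[_ ltxi].
  by rewrite -mulrA ladder_comm // mulrA hU ?scalerAl //; lia.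
- have -> : h * P i * U i = h * P i.+1 by rewrite big_nat_recr //= mulrA.
  rewrite ladder_top // addrA -{1}[h * P i.+1]scale1r -scalerDl.
  by rewrite [1 + _]addrC subrK addrC.
by apply: eq_big_nat => x /andP[ltix lexL]; rewrite ladder_low.
Qed.

(** The returning product starts with the top letter of [P x], where the quadratic relation splits
    off a multiple of [P x], on which all further letters act by [q], and the shorter [P (x-1)], to
    which induction applies. The factor [q] on the left avoids the exponent [x - 1]. *)
Lemma ladder_fold x : (x <= L)%N ->
  q *: (h * P x * \prod_(0 <= k < x) U (x - k.+1)%N) =
  ((q - 1) * q ^+ x) *: (h * \sum_(1 <= y < x.+1) P y) + q ^+ x.+1 *: h.
Proof.
have low z y : (y < z)%N -> (z <= L)%N ->
    h * P z * \prod_(0 <= k < y) U (y - k.+1)%N = q ^+ y *: (h * P z).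
  elim: y => [|y IH] ltyx lexL; first by rewrite (big_geq (leqnn 0)) mulr1 scale1r.
  rewrite [X in _ * X]big_nat_recl //= subn1 /= mulrA ladder_low // -scalerAl.
  rewrite (eq_big_nat _ _ (F2 := fun k => U (y - k.+1)%N)); last by move=> k _; rewrite subSS.
  by rewrite IH ?(ltnW ltyx) // scalerA exprS.
elim: x => [|x IH] lexL.
  by rewrite !big_geq // !mulr1 mulr0 scaler0 add0r.
rewrite [X in _ * X]big_nat_recl //= subn1 /= mulrA ladder_top // mulrDl -!scalerAl.
rewrite (eq_big_nat _ _ (F2 := fun k => U (x - k.+1)%N)); last by move=> k _; rewrite subSS.
have -> : \sum_(1 <= y < x.+2) P y = \sum_(1 <= y < x.+1) P y + P x.+1.
  by rewrite big_nat_recr.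
rewrite low // scalerDr IH ?(ltnW lexL) // mulrDr !scalerDr !scalerA !addrA.
rewrite -!exprS; congr (_ + _); rewrite addrC; congr (_ *: _ + _ *: _).
  by rewrite exprS mulrCA.
by rewrite exprS mulrCA -mulrA.
Qed.

End Ladder.

Section JucysMurphy.
Variables (K : fieldType) (q : K) (n : nat).
Hypothesis q0 : q != 0.
Local Notation H := (heckeAlg q n).
Local Notation TT := (@basisT K q n).
Local Notation T := (@genT K q n).
Local Notation Lq := (@jucys_murphy K q n).

Lemma comm_scale (a : K) (x y : H) : x * y = y * x -> x * (a *: y) = a *: y * x.
Proof. by move=> E; rewrite -scalerAr E scalerAl. Qed.

Lemma comm_D (x y z : H) : x * y = y * x -> x * z = z * x -> x * (y + z) = (y + z) * x.
Proof. by move=> E1 E2; rewrite mulrDr mulrDl E1 E2. Qed.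

Lemma comm_M (x y z : H) : x * y = y * x -> x * z = z * x -> x * (y * z) = (y * z) * x.
Proof. by move=> E1 E2; rewrite mulrA E1 -!mulrA E2. Qed.

Lemma comm_prod (I : eqType) (r : seq I) (x : H) (F : I -> H) :
  (forall i, i \in r -> x * F i = F i * x) -> x * \prod_(i <- r) F i = \prod_(i <- r) F i * x.
Proof.
elim: r => [|i r IH] E; first by rewrite big_nil mulr1 mul1r.
rewrite big_cons; apply: comm_M; first by apply: E; rewrite mem_head.
by apply: IH => j jr; apply: E; rewrite inE jr orbT.
Qed.

Lemma comm_sum (I : eqType) (r : seq I) (x : H) (F : I -> H) :
  (forall i, i \in r -> x * F i = F i * x) -> x * (\sum_(i <- r) F i) = (\sum_(i <- r) F i) * x.
Proof. by move=> E; rewrite mulr_sumr mulr_suml; apply: eq_big_seq. Qed.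

Lemma T_Lq_gt i m : (m < i)%N -> (m <= n)%N -> T i * Lq m = Lq m * T i.
Proof.
elim: m => [|m IH] ltmi lemn; first by rewrite /jucys_murphy /Lm big_geq // mulr0 mul0r.
case: (posnP m) => [->|m0]; first by rewrite Lq1 mulr0 mul0r.
rewrite LqS ?m0 //; apply: comm_scale.
have E : T i * T m = T m * T i by rewrite -T_comm.
have EL : T i * Lq m = Lq m * T i by apply: IH; apply: ltnW.
exact: comm_D (comm_M (comm_M E EL) E) E.
Qed.

Lemma T_Lq_lt i m : (0 < i)%N -> (i.+1 < m)%N -> (m <= n)%N -> T i * Lq m = Lq m * T i.
Proof.
move=> i0; elim: m => // m IH; rewrite ltnS leq_eqVlt => /orP[/eqP Em|ltim] lemn; last first.
  rewrite LqS; [|lia|by []]; apply: comm_scale.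
  have E : T i * T m = T m * T i by rewrite T_comm.
  have EL : T i * Lq m = Lq m * T i by apply: IH => //; apply: ltnW.
  exact: comm_D (comm_M (comm_M E EL) E) E.
(* The case [m = i+2]: two steps of the recursion express [L_(i+2)] through [L_i], which commutes
   with [T_(i+1)]; the rest is the braid relation. *)
rewrite -Em in lemn *; have ltiS : (i.+1 < n)%N by [].
rewrite LqS; [|lia|by []]; apply: comm_scale.
rewrite LqS ?i0 1?ltnW // -scalerAr -scalerAl.
set a := T i; set b := T i.+1; set l := Lq i.
have br : a * b * a = b * a * b by exact: T_braid.
have bl : b * l = l * b by apply: T_Lq_gt => //; lia.
have E1 : a * (b * (a * l * a) * b) = b * (a * l * a) * b * a.
  by rewrite !mulrA br -(mulrA _ b l) bl mulrA -(mulrA _ b a) -(mulrA _ (b * a) b) -br !mulrA.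
have E2 : a * (b * a * b + q *: b) = (b * a * b + q *: b) * a.
  rewrite -br mulrDr mulrDl !mulrA T_quad ?i0 1?ltnW // -[in RHS](mulrA (a * b)).
  rewrite T_quad ?i0 1?ltnW // !mulrDl !mulrDr -!scalerAl -!scalerAr mul1r mulr1.
  by rewrite -/a addrAC.
have -> : b * (a * l * a + a) * b = b * (a * l * a) * b + b * a * b.
  by rewrite mulrDr mulrDl.
rewrite scalerDr -addrA.
have -> : q^-1 *: (b * a * b) + b = q^-1 *: (b * a * b + q *: b).
  by rewrite scalerDr scalerA mulVf // scale1r.
by rewrite -scalerDr; apply: comm_scale; apply: comm_D.
Qed.

Lemma Lq_comm i m : (0 < i <= n)%N -> (0 < m <= n)%N -> Lq i * Lq m = Lq m * Lq i.
Proof.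
suff lt j k : (0 < j)%N -> (j < k)%N -> (k <= n)%N -> Lq j * Lq k = Lq k * Lq j.
  move=> /andP[i0 lei] /andP[m0 lem]; case: (ltngtP i m) => [l|l|->//]; first exact: lt.
  by symmetry; apply: lt.
elim: j => // j IH _ ltjk lekn; case: (posnP j) => [->|j0]; first by rewrite Lq1 mulr0 mul0r.
rewrite LqS; [|lia|by []]; symmetry; apply: comm_scale.
have E : Lq k * T j = T j * Lq k by rewrite T_Lq_lt.
have EL : Lq k * Lq j = Lq j * Lq k by rewrite IH // ltnW.
exact: comm_D (comm_M (comm_M E EL) E) E.
Qed.

Lemma T_LqS m : (0 < m < n)%N -> T m * Lq m.+1 = Lq m * T m + ((q - 1) *: Lq m.+1 + 1).
Proof.
move=> ltm; rewrite LqS // -scalerAr mulrDr !mulrA T_quad // !mulrDl !scalerDr !scalerA.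
rewrite -!scalerAl !mul1r !scalerA (mulrC q^-1 q) mulfV // !scale1r (mulrC q^-1).
by rewrite [_ + Lq m * T m]addrC -!addrA.
Qed.

Lemma T_Lq m : (0 < m < n)%N -> T m * Lq m = Lq m.+1 * T m - ((q - 1) *: Lq m.+1 + 1).
Proof.
move=> ltm; apply/esym/eqP; rewrite subr_eq; apply/eqP.
rewrite LqS // -scalerAl mulrDl -!mulrA T_quad // !mulrDr !scalerDr.
rewrite -!scalerAr !mulr1 !scalerA (mulrC q^-1 q) mulfV // !scale1r (mulrC q^-1).
by rewrite [_ + T m * Lq m]addrC -!addrA.
Qed.

(** This is the multiplicative Jucys-Murphy element. Unlike the sum [L], its palindromic form can be
    cut at row boundaries, so that the eigenvalue is collected row by row. *)
Lemma Lq_JM p : (p < n)%N ->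
  1 + (q - 1) *: Lq p.+1 =
  q ^- p *: ((\prod_(0 <= k < p) T (p - k)) * \prod_(0 <= k < p) T k.+1).
Proof.
elim: p => [|p IH] ltpn; first by rewrite Lq1 scaler0 addr0 !big_geq // mulr1 expr0 invr1 scale1r.
rewrite big_nat_recl // subn0 big_nat_recr //=.
rewrite (eq_big_nat _ _ (F2 := fun k => T (p - k))); last by move=> k _; rewrite subSS.
rewrite -mulrA (mulrA (\prod_(0 <= k < p) T (p - k))) mulrA.
set X := (X in T _ * X * _).
have -> : q ^- p.+1 *: (T p.+1 * X * T p.+1) = q^-1 *: (T p.+1 * (q ^- p *: X) * T p.+1).
  by rewrite -scalerAr -scalerAl scalerA -invfM -exprS.
rewrite -IH 1?ltnW //.
rewrite LqS // mulrDr mulr1 mulrDl T_quad // -scalerAr -scalerAl !scalerDr !scalerA mulVf // scale1r.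
rewrite (mulrC q^-1) [_ *: T p.+1 + 1]addrC -addrA; congr (_ + _).
by rewrite addrC.
Qed.

End JucysMurphy.

(** * Compositions and row symmetrizers *)

Section Compositions.
Implicit Types (la rho A B C : seq nat).

Lemma part_sum_le la r s : (r <= s)%N -> (part_sum la r <= part_sum la s)%N.
Proof.
move=> lers; rewrite /part_sum -(subnKC lers) takeD sumn_cat; exact: leq_addr.
Qed.

Lemma part_sum_full la r : (size la <= r)%N -> part_sum la r = sumn la.
Proof. by move=> le; rewrite /part_sum take_oversize. Qed.

Lemma row_ofP la x : (x < sumn la)%N ->
  (row_of la x < size la)%N /\ (part_sum la (row_of la x) <= x < part_sum la (row_of la x).+1)%N.
Proof.
move=> ltx; rewrite /row_of; set a := (fun r => _).
have hs : has a (iota 0 (size la)).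
  case: la ltx @a => [|y la] // ltx a; apply/hasP; exists (size la); first by rewrite mem_iota /=.
  by rewrite /a part_sum_full.
have ltr := hs; rewrite has_find size_iota in ltr; split=> //.
have := nth_find 0%N hs; rewrite nth_iota // add0n {1}/a => ->; rewrite andbT.
case E : (find a _) => [|r]; first by rewrite /part_sum take0.
have ltr' : (r < find a (iota 0 (size la)))%N by rewrite E.
have := before_find 0%N ltr'; rewrite nth_iota ?add0n; last exact: ltn_trans ltr' ltr.
by rewrite /a => /negbT; rewrite -leqNgt.
Qed.

Lemma row_of_uniq la x r : (part_sum la r <= x < part_sum la r.+1)%N -> row_of la x = r.
Proof.
move=> /andP[ler ltr].
have ltx : (x < sumn la)%N.
  apply: leq_trans ltr _; rewrite -(part_sum_full (leq_maxl (size la) r.+1)).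
  by apply: part_sum_le; apply: leq_maxr.
have [_ /andP[l1 l2]] := row_ofP ltx.
case: (ltngtP (row_of la x) r) => // lt.
  by have := leq_trans l2 (leq_trans (part_sum_le la lt) ler); rewrite ltnn.
by have := leq_trans ltr (leq_trans (part_sum_le la lt) l1); rewrite ltnn.
Qed.

Lemma row_of_mono la x y : (x <= y)%N -> (y < sumn la)%N -> (row_of la x <= row_of la y)%N.
Proof.
move=> lexy lty; rewrite leqNgt; apply/negP => lt.
have [_ /andP[l1 _]] := row_ofP (leq_ltn_trans lexy lty).
have [_ /andP[_ l2]] := row_ofP lty.
have := leq_trans l2 (leq_trans (part_sum_le la lt) l1).
by rewrite ltnNge lexy.
Qed.

(* The positions [i] such that the entries [i] and [i.+1] lie in different rows. *)
Definition breaks_from (o : nat) (rho : seq nat) := scanl addn o rho.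
Definition breaks rho := breaks_from 0 rho.

Lemma breaks_from_cat o A B :
  breaks_from o (A ++ B) = breaks_from o A ++ breaks_from (o + sumn A) B.
Proof.
rewrite /breaks_from scanl_cat; congr (_ ++ scanl _ _ _).
by elim: A o => [|a A IH] o /=; rewrite ?addn0 // IH addnA.
Qed.

Lemma breaks_from_bound o A i : i \in breaks_from o A -> (o <= i <= o + sumn A)%N.
Proof.
elim: A o => [|a A IH] o //=; rewrite inE => /orP[/eqP->|/IH/andP[l1 l2]].
  by rewrite leq_addr /= addnA leq_addr.
by rewrite addnA l2 andbT (leq_trans _ l1) // leq_addr.
Qed.

Lemma breaks_from_last o a A : (o + sumn (a :: A))%N \in breaks_from o (a :: A).
Proof.
elim: A a o => [|b A IH] a o; first by rewrite /= addn0 mem_head.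
have := IH b (o + a)%N; rewrite /= !addnA => E.
by rewrite inE E orbT.
Qed.

Lemma breaks_fromS o A : breaks_from o.+1 A = map S (breaks_from o A).
Proof. by elim: A o => //= a A IH o; rewrite addSn IH. Qed.

Lemma breaksP rho i : i \in breaks rho -> exists r, i = part_sum rho r.+1.
Proof.
have gen o : i \in breaks_from o rho -> exists r, i = (o + part_sum rho r.+1)%N.
  elim: rho o => //= a A IH o; rewrite inE => /orP[/eqP->|/IH[r ->]].
    by exists 0%N; rewrite /part_sum /= take0 /= addn0.
  by exists r.+1; rewrite /part_sum /= addnA.
exact: gen.
Qed.

Lemma mem_breaks rho r : (r < size rho)%N -> part_sum rho r.+1 \in breaks rho.
Proof.
have gen o : (r < size rho)%N -> (o + part_sum rho r.+1)%N \in breaks_from o rho.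
  elim: rho r o => // a A IH [|r] o /=; first by rewrite /part_sum /= take0 addn0 mem_head.
  by move=> /(IH _ (o + a)%N); rewrite inE /part_sum /= addnA => ->; rewrite orbT.
exact: gen.
Qed.

Lemma notin_breaks rho r i : (part_sum rho r < i < part_sum rho r.+1)%N -> i \notin breaks rho.
Proof.
move=> /andP[l1 l2]; apply/negP => /breaksP[s Ei]; rewrite Ei in l1 l2.
case: (leqP s.+1 r) => [le|lt].
  by have := leq_trans l1 (part_sum_le rho le); rewrite ltnn.
by have := leq_trans l2 (part_sum_le rho lt); rewrite ltnn.
Qed.

Lemma same_rowE rho i : (0 < i < sumn rho)%N -> i \notin breaks rho ->
  row_of rho i.-1 = row_of rho i.
Proof.
move=> /andP[i0 lti] nb; have [ltr /andP[l1 l2]] := row_ofP lti.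
apply: row_of_uniq; apply/andP; split; last by apply: leq_ltn_trans l2; apply: leq_pred.
case E : (row_of rho i) => [|r] in l1 ltr *; first by rewrite /part_sum take0.
move: l1; rewrite leq_eqVlt => /orP[/eqP El|]; last by case: i i0 {lti nb E l2}.
by rewrite -El mem_breaks // ltnW in nb.
Qed.

Lemma diff_rowE rho i : (0 < i < sumn rho)%N -> i \in breaks rho ->
  (row_of rho i.-1 < row_of rho i)%N.
Proof.
move=> /andP[i0 lti] /breaksP[r Ei].
have [ltr /andP[l1 l2]] := row_ofP lti.
have lti' : (i.-1 < sumn rho)%N by apply: leq_ltn_trans lti; apply: leq_pred.
have [_ /andP[l1' l2']] := row_ofP lti'.
have ler : (row_of rho i.-1 <= r)%N.
  rewrite leqNgt; apply/negP => lt.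
  have := part_sum_le rho lt; rewrite -Ei; move: l1'; case: i i0 {lti lti' Ei l1 l2 l2' ltr lt} => //= i _ l1 l2.
  by have := leq_trans l2 l1; rewrite ltnn.
apply: leq_ltn_trans ler _; rewrite ltnNge; apply/negP => le.
have lt : (row_of rho i < r.+1)%N by [].
by have := leq_trans l2 (part_sum_le rho lt); rewrite -Ei ltnn.
Qed.

(** Decreasing order maximises partial sums. The auxiliary statement splits the entries in two parts
    arbitrarily, so that induction can discard the largest entry from whichever part holds it, an
    entry of the first part giving way if it lies in the second. *)
Lemma sumn_take_dominated s t r : sorted geq t -> perm_eq s t ->
  (sumn (take r s) <= sumn (take r t))%N.
Proof.
have gen u s1 s2 : sorted geq u -> perm_eq (s1 ++ s2) u -> (sumn s1 <= sumn (take (size s1) u))%N.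
  elim: u s1 s2 => [|x u IH] s1 s2 su pu.
    by have := perm_size pu; rewrite size_cat; case: s1 {pu}.
  case: s1 pu => [|y s1] pu //=.
  have su' : sorted geq u by apply: path_sorted su.
  have /allP ux : all (geq x) u by apply: order_path_min su => a b c /= l1 l2; apply: leq_trans l2 l1.
  have lex z : z \in (y :: s1) ++ s2 -> (z <= x)%N.
    by rewrite (perm_mem pu) inE => /orP[/eqP->//|/ux].
  have := mem_head x u; rewrite -(perm_mem pu) mem_cat => /orP[xs1|xs2].
    have ps := perm_to_rem xs1.
    have -> : (y + sumn s1 = x + sumn (rem x (y :: s1)))%N.
      by have := perm_sumn ps.
    have -> : size s1 = size (rem x (y :: s1)) by rewrite size_rem.
    rewrite leq_add2l; apply: (IH _ s2) => //.
    by rewrite -(perm_cons x) -(permPr pu) perm_sym -cat_cons perm_cat2r.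
  apply: leq_add; first by apply: lex; rewrite mem_head.
  apply: (IH _ (y :: rem x s2)) => //; rewrite -(perm_cons x) -(permPr pu).
  have ps := perm_to_rem xs2.
  rewrite -cat_cons perm_sym (permPl (_ : perm_eq _ (y :: s1 ++ (x :: rem x s2)))).
    by apply/seq.permP => a; rewrite /= !count_cat /=; lia.
  by rewrite /= perm_cons perm_cat2l.
move=> st pst; have [le|lt] := leqP r (size s).
  rewrite -[in leqRHS](size_takel le); apply: (gen t _ (drop r s)) => //.
  by rewrite cat_take_drop.
rewrite (take_oversize (ltnW lt)) take_oversize ?(perm_sumn pst) //.
by rewrite -(perm_size pst) ltnW.
Qed.

End Compositions.

(* Positivity of the Poincare polynomials is what makes [x_rho] a quasi-idempotent. *)
Definition generic (K : fieldType) (q : K) : Prop :=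
  [/\ q != 0, q != 1 & forall s : seq nat, s != [::] -> \sum_(i <- s) q ^+ i != 0].

Section RowSymmetrizer.
Variables (K : fieldType) (q : K) (n : nat).
Hypothesis gq : generic q.
Local Notation H := (heckeAlg q n).
Local Notation TT := (@basisT K q n).
Local Notation T := (@genT K q n).
Implicit Types (la rho mu A B C : seq nat) (h : H) (w : 'S_n).

Definition rowsym rho : H := xla K n rho.
Local Notation X := rowsym.

Definition row_symmetric rho h :=
  forall i, (0 < i < n)%N -> i \notin breaks rho -> h * T i = q *: h.

Lemma rowstab_sgen rho w i : sumn rho = n -> (0 < i < n)%N -> i \notin breaks rho ->
  ((w * sgen n i)%g \in rowstab n rho) = (w \in rowstab n rho).
Proof.
move=> Sn lti nb.
have Ei := same_rowE (rho := rho) (i := i); rewrite Sn in Ei; have {}Ei := Ei lti nb.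
have row_s (x : 'I_n) : row_of rho (sgen n i x) = row_of rho x.
  by rewrite sgenE //; case: eqP => [->//|_]; case: eqP => [->|].
rewrite !inE; apply/forallP/forallP => E x; first by rewrite -(eqP (E x)) permM row_s.
by rewrite permM row_s.
Qed.

(** The permutations [w] and [w s_i] lie in the row stabilizer together. On such a pair the
    quadratic relation produces the eigenvalue [q]. *)
Lemma rowsym_T rho i : sumn rho = n -> (0 < i < n)%N -> i \notin breaks rho -> X rho * T i = q *: X rho.
Proof.
move=> Sn lti nb; rewrite /rowsym /xla -[\sum_(_ in _) _]/(\sum_(w in rowstab n rho) TT w : H).
rewrite mulr_suml scaler_sumr (bigID (fun w => rasc w i)) [RHS](bigID (fun w => rasc w i)) /=.
have inv_s : involutive (fun w : 'S_n => w * sgen n i)%g.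
  by move=> w; rewrite -mulgA sgenK mulg1.
have flip (b : bool) (F : 'S_n -> H) :
    \sum_(w in rowstab n rho | rasc w i == b) F (w * sgen n i)%g
      = \sum_(w in rowstab n rho | rasc w i == ~~ b) F w.
  rewrite [RHS](reindex_inj (inv_inj inv_s)) /=; apply: eq_bigl => w.
  by rewrite rowstab_sgen // rasc_Msgen // (inj_eq (can_inj negbK)).
have eqbT w : rasc w i = (rasc w i == true) by rewrite eqb_id.
have eqbF w : ~~ rasc w i = (rasc w i == false) by rewrite eqbF_neg.
pose S b : H := \sum_(w in rowstab n rho | rasc w i == b) TT w.
have -> : \sum_(w in rowstab n rho | rasc w i) TT w * T i = S false.
  rewrite -[S false](flip true) (eq_bigl _ _ (fun w => congr1 (andb _) (eqbT w))).
  by apply: eq_bigr => w /andP[_ /eqP A]; rewrite TT_T // A.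
have -> : \sum_(w in rowstab n rho | ~~ rasc w i) TT w * T i = q *: S true + (q - 1) *: S false.
  rewrite -[S true](flip false) /S !scaler_sumr -big_split /=.
  rewrite (eq_bigl _ _ (fun w => congr1 (andb _) (eqbF w))).
  by apply: eq_bigr => w /andP[_ /eqP A]; rewrite TT_T // A.
have -> : \sum_(w in rowstab n rho | rasc w i) q *: TT w = q *: S true.
  by rewrite /S scaler_sumr; apply: eq_bigl => w; rewrite -eqbT.
have -> : \sum_(w in rowstab n rho | ~~ rasc w i) q *: TT w = q *: S false.
  by rewrite /S scaler_sumr; apply: eq_bigl => w; rewrite -eqbF.
by rewrite addrCA -{1}[S false]scale1r -scalerDl [1 + _]addrC subrK.
Qed.

Lemma row_symmetric_TT rho h w : sumn rho = n -> row_symmetric rho h ->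
  w \in rowstab n rho -> h * TT w = q ^+ perm_len w *: h.
Proof.
move=> Sn sh; move: {2}(perm_len w) (erefl (perm_len w)) => f; elim: f w => [|f IH] w Ef rw.
  rewrite Ef scale1r; have [->|/exists_rdesc[i lti /(perm_len_rdesc lti)]] := eqVneq w 1%g.
    by rewrite TT1 mulr1.
  by rewrite Ef.
have [w1|/exists_rdesc[i lti ni]] := eqVneq w 1%g; first by move: Ef; rewrite w1 perm_len1.
(* A right descent at a row boundary would put two values of different rows in the wrong order,
   impossible for a permutation preserving rows. *)
have nb : i \notin breaks rho.
  apply: contra ni => bi; have [a [b [Eb Ei _]]] := sgenP lti.
  rewrite Ei (rascE _ Eb).
  have ltr : (row_of rho a < row_of rho b)%N.
    by have := @diff_rowE rho i; rewrite Sn => /(_ lti bi); rewrite Ei {1}Eb.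
  rewrite ltnNge; apply: contraL ltr => le; rewrite -leqNgt.
  move: rw; rewrite inE => /forallP rw.
  rewrite -(permKV w a) -(permKV w b) (eqP (rw _)) (eqP (rw _)).
  by apply: row_of_mono; rewrite ?Sn.
have := perm_len_rdesc lti ni; rewrite Ef => -[Ef'].
have rws : (w * sgen n i)%g \in rowstab n rho by rewrite rowstab_sgen.
have -> : w = (w * sgen n i * sgen n i)%g by rewrite -mulgA sgenK mulg1.
rewrite TT_sgen // ?rasc_Msgen // mulrA IH // -scalerAl sh // scalerA.
by rewrite -Ef' exprSr.
Qed.

(* [c] is the Poincare polynomial of the row stabilizer at [q]. *)
Lemma row_symmetric_rowsym rho h : sumn rho = n -> row_symmetric rho h ->
  exists2 c : K, c != 0 & h * X rho = c *: h.
Proof.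
move=> Sn sh; exists (\sum_(w in rowstab n rho) q ^+ perm_len w).
  case: gq => _ _ pos.
  have := pos [seq perm_len w | w in rowstab n rho]; rewrite /image_mem big_map big_enum /=.
  apply; rewrite -size_eq0 size_map -cardE cards_eq0; apply/set0Pn; exists 1%g.
  by rewrite inE; apply/forallP => x; rewrite perm1.
rewrite /rowsym /xla -[\sum_(_ in _) _]/(\sum_(w in rowstab n rho) TT w : H).
rewrite mulr_sumr scaler_suml; apply: eq_bigr => w rw.
exact: row_symmetric_TT Sn sh rw.
Qed.

(** * The ideal of the strictly dominating partitions and the compositions it absorbs *)

Section Nbar.
Variable la : seq nat.

Definition Nbar (h : H) : Prop := inNbar q la h.
Local Notation N := Nbar.

Lemma Nbar0 : N 0.
Proof. by exists [::]; split => //; rewrite big_nil. Qed.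

Lemma Nbar_add h g : N h -> N g -> N (h + g).
Proof.
move=> [s [ps ->]] [t [pt ->]]; exists (s ++ t); split; last by rewrite big_cat.
by move=> p; rewrite mem_cat => /orP[/ps|/pt].
Qed.

Lemma Nbar_scale (a : K) h : N h -> N (a *: h).
Proof.
move=> [s [ps ->]]; exists [seq (p.1, a * p.2) | p <- s]; split.
  by move=> p /mapP[p' /ps ? ->].
rewrite big_map scaler_sumr; apply: eq_bigr => p _ /=.
exact: (@scalerA K H).
Qed.

Lemma Nbar_opp h : N h -> N (- h).
Proof. by rewrite -scaleN1r; apply: Nbar_scale. Qed.

Lemma Nbar_sub h g : N h -> N g -> N (h - g).
Proof. by move=> Nh Ng; apply: Nbar_add => //; apply: Nbar_opp. Qed.

Lemma Nbar_sum (I : eqType) (r : seq I) (F : I -> H) :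
  (forall i, i \in r -> N (F i)) -> N (\sum_(i <- r) F i).
Proof.
elim: r => [|i r IH] NF; first by rewrite big_nil; apply: Nbar0.
rewrite big_cons; apply: Nbar_add; first by apply: NF; rewrite mem_head.
by apply: IH => j jr; apply: NF; rewrite inE jr orbT.
Qed.

Lemma Nbar_gen mu (a b : H) : is_partition n mu -> strictly_dominates mu la -> N (a * X mu * b).
Proof.
move=> pm dm; rewrite (heckeE a) (heckeE b) 2!mulr_suml.
apply: Nbar_sum => u _; rewrite mulr_sumr; apply: Nbar_sum => v _.
rewrite -!scalerAl -scalerAr; do 2!apply: Nbar_scale.
exists [:: (mu, u^-1%g, v, 1)]; split; first by move=> p; rewrite inE => /eqP->.
rewrite big_seq1 /= invgK !mulHE; exact/esym/(@scale1r K H).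
Qed.

Lemma Nbar_ideal (a b h : H) : N h -> N (a * h * b).
Proof.
move=> [s [ps ->]]; rewrite mulr_sumr mulr_suml; apply: Nbar_sum => p /ps[pm dm].
set x := hscale _ _.
have -> : x = p.2 *: (TT (p.1.1.2)^-1%g * X p.1.1.1 * TT p.1.2) by rewrite !mulHE.
rewrite -scalerAr -scalerAl; apply: Nbar_scale.
rewrite !mulrA -[_ * TT _ * b]mulrA; exact: Nbar_gen.
Qed.

Lemma Nbar_mulr h (b : H) : N h -> N (h * b).
Proof. by move=> /(Nbar_ideal 1 b); rewrite mul1r. Qed.

(** Reduces a Garnir relation to an invariance check under the generators inside the rows of one
    composition. *)
Definition absorbs rho := forall h, row_symmetric rho h -> N h.

(** Let [w] interchange the two adjacent blocks of entries. Then [h T_w] is row symmetric for the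
    swapped composition, and [T_w] has a right inverse, so [h] follows. *)
Lemma absorbs_swap A B (a b : nat) : sumn (A ++ a :: b :: B) = n ->
  absorbs (A ++ b :: a :: B) -> absorbs (A ++ a :: b :: B).
Proof.
move=> Sn abs h sh; pose o := sumn A.
have Sn' : (o + (a + (b + sumn B)) = n)%N by rewrite -Sn sumn_cat.
pose f (x : nat) := (if x < o then x else if x < o + a then x + b
  else if x < o + a + b then x - a else x)%N.
have f_lt (x : 'I_n) : (f x < n)%N.
  have := ltn_ord x; rewrite /f; do 3?(case: ifP => ?); lia.
have f_inj : injective (fun x : 'I_n => Ordinal (f_lt x)).
  move=> x y /(congr1 val) /= E; apply: val_inj => /=; move: E; rewrite /f.
  do 3?(case: ifP => ?); do 3?(case: ifP => ?); lia.
pose w := perm f_inj.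
have [|v Ev] := TT_rinv (q := q) w; first by case: gq.
rewrite -[h]mulr1 -Ev mulrA; apply: Nbar_mulr; apply: abs => j ltj nj.
move: nj; rewrite /breaks breaks_from_cat add0n /= mem_cat !inE !negb_or -/o.
move=> /and4P[njA njb nja njB].
have nj0 : j != o.
  case EA : A njA => [|x A'] njA; first by rewrite /o EA /=; lia.
  apply: contra njA => /eqP->; have := breaks_from_last 0 x A'.
  by rewrite add0n -EA.
(* A generator inside a row of the swapped composition is the conjugate by [w] of one inside a row
   of the original composition, which [h] absorbs. *)
have conj i : (0 < i < n)%N -> f i = j -> f i.-1 = j.-1 ->
    i \notin breaks (A ++ a :: b :: B) -> h * TT w * T j = q *: (h * TT w).
  move=> lti Ei Ei1 ni; have [i1 [i2 [Ei2 Eii _]]] := sgenP lti.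
  have [j1 [j2 [Ej2 Ejj _]]] := sgenP ltj.
  have E : T i * TT w = TT w * T j.
    rewrite Eii Ejj; apply: (@T_TT_conj K q n w i1 i2 j1 j2) => //; apply: val_inj; rewrite permE /=.
      by move: Ei1; rewrite Eii Ejj Ei2 Ej2.
    by move: Ei; rewrite Eii Ejj.
  by rewrite -mulrA -E mulrA sh // scalerAl.
have notA i : (o < i)%N -> i \notin breaks_from 0 A.
  by move=> lt; apply/negP => /breaks_from_bound; rewrite add0n; lia.
have notB i : (i < o + a + b)%N -> i \notin breaks_from (o + a + b) B.
  by move=> lt; apply/negP => /breaks_from_bound; lia.
have notin i : i \notin breaks_from 0 A -> (i != o + a)%N -> (i != o + a + b)%N ->
    i \notin breaks_from (o + a + b) B -> i \notin breaks (A ++ a :: b :: B).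
  move=> i1 i2 i3 i4; rewrite /breaks breaks_from_cat add0n /= mem_cat !inE !negb_or -/o.
  by rewrite i1 i2 i3.
have EB : (o + b + a = o + a + b)%N by lia.
rewrite EB in nja njB.
case: (ltnP j o) => jo.
  apply: (conj j) => //; rewrite /f ?jo //; first by case: ifP => ?; lia.
  by apply: notin; [by []|lia|lia|apply: notB; lia].
case: (ltnP j (o + b)) => job.
  apply: (conj (j + a)%N); rewrite /f; try lia.
  - by do 3?(case: ifP => ?); lia.
  - by do 3?(case: ifP => ?); lia.
  by apply: notin; [apply: notA|..|apply: notB]; lia.
case: (ltnP j (o + a + b)) => joab.
  apply: (conj (j - b)%N); rewrite /f; try lia.
  - by do 3?(case: ifP => ?); lia.
  - by do 3?(case: ifP => ?); lia.
  by apply: notin; [apply: notA|..|apply: notB]; lia.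
apply: (conj j); rewrite /f; try lia.
- by do 3?(case: ifP => ?); lia.
- by do 3?(case: ifP => ?); lia.
by apply: notin; [apply: notA; lia|lia|lia|by []].
Qed.

(** Adjacent swaps suffice: the head of [rho] is located in [rho'] and carried to the front there.
    Entries already in place accumulate in the prefix [A]. *)
Lemma absorbs_perm A rho rho' : perm_eq rho rho' -> sumn (A ++ rho) = n ->
  absorbs (A ++ rho') -> absorbs (A ++ rho).
Proof.
elim: rho A rho' => [|x rho IH] A rho' pr Sn abs.
  by move: pr; rewrite perm_sym => /perm_nilP Er; rewrite Er in abs.
have xr : x \in rho' by rewrite -(perm_mem pr) mem_head.
move: pr abs; case/splitPr: xr => r1 r2 pr abs.
have pr' : perm_eq rho (r1 ++ r2).
  by rewrite -(perm_cons x) (permPl pr) perm_catC /= perm_cons perm_catC.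
rewrite -cat_rcons; apply: (IH _ (r1 ++ r2)) => //; first by rewrite cat_rcons.
rewrite cat_rcons; have {Sn}: sumn (A ++ r1 ++ x :: r2) = n.
  by rewrite -Sn !sumn_cat; congr (_ + _)%N; rewrite (perm_sumn pr) sumn_cat.
elim/last_ind: r1 r2 {pr pr'} abs => [|r1 y IH1] r2 abs Sn //.
rewrite cat_rcons; apply: IH1; last by rewrite -Sn !sumn_cat -cats1 sumn_cat /=; lia.
rewrite catA; apply: absorbs_swap; first by rewrite -Sn !sumn_cat -cats1 sumn_cat /=; lia.
by rewrite -catA -cat_rcons.
Qed.

Lemma absorbs_sort rho : sumn rho = n ->
  (exists r, part_sum la r < part_sum rho r)%N ->
  (forall r, part_sum la r <= part_sum rho r)%N -> absorbs rho.
Proof.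
move=> Sn [r0 lt0] dom; pose tau := sort geq rho; pose mu := [seq x <- tau | 0 < x]%N.
have stau : sorted geq tau by apply: sort_sorted => a b; apply: leq_total.
(* Empty rows are sorted to the end. Dropping them changes neither partial sums nor the breaks
   strictly between 0 and [n]. *)
have ptau : perm_eq rho tau by rewrite perm_sym perm_sort.
have Etau : tau = mu ++ nseq (size tau - size mu) 0%N.
  rewrite /mu; elim: (tau) stau => //= x t IH st.
  case: (posnP x) => x0 /=; last by rewrite subSS {1}IH ?(path_sorted st).
  have /allP t0 : all (geq x) t.
    by apply: order_path_min st => a b c /= l1 l2; apply: leq_trans l2 l1.
  have -> : [seq x <- t | 0 < x]%N = [::].
    apply/eqP; rewrite -(negbK (_ == _)) -has_filter -all_predC; apply/allP => y /t0 /=.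
    by rewrite x0 -leqNgt.
  rewrite cat0s [size [::]]/= subn0 /= x0; congr (_ :: _); apply/all_pred1P/allP => y /t0 /=.
  by rewrite x0 leqn0.
have Stau : sumn tau = n by rewrite -(perm_sumn ptau).
have Smu : sumn mu = n by rewrite -Stau Etau sumn_cat sumn_nseq mul0n addn0.
have ps_mu r : part_sum mu r = part_sum tau r.
  have zeros k m : sumn (take k (nseq m 0%N)) = 0%N by elim: m k => [|m IH] [|k] //=; rewrite IH.
  rewrite /part_sum Etau take_cat; case: ltnP => // le.
  by rewrite take_oversize // sumn_cat zeros addn0.
have dom_mu r : (part_sum rho r <= part_sum mu r)%N.
  by rewrite ps_mu; apply: sumn_take_dominated.
have part_mu : is_partition n mu.
  apply/and3P; split; last by rewrite Smu.
    by apply: sorted_filter stau => a b c /= l1 l2; apply: leq_trans l2 l1.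
  exact: filter_all.
have strict_mu : strictly_dominates mu la.
  split; first by move=> r; apply: leq_trans (dom r) (dom_mu r).
  by move=> E; have := leq_trans lt0 (dom_mu r0); rewrite E ltnn.
apply: (@absorbs_perm [::] rho tau) => // h sh.
have sh' : row_symmetric mu h.
  move=> i lti nb; apply: sh => //.
  rewrite cat0s Etau /breaks breaks_from_cat mem_cat negb_or -/(breaks mu) nb /= add0n Smu.
  by apply/negP => /breaks_from_bound; lia.
have [c c0 E] := row_symmetric_rowsym Smu sh'.
have -> : h = c^-1 *: (h * X mu * 1) by rewrite mulr1 E scalerA mulVf // scale1r.
by apply: Nbar_scale; apply: Nbar_gen.
Qed.

End Nbar.
End RowSymmetrizer.

(** * Garnir relations *)

Section Garnir.
Variables (K : fieldType) (q : K) (n : nat).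
Hypothesis gq : generic q.
Local Notation H := (heckeAlg q n).
Local Notation TT := (@basisT K q n).
Local Notation T := (@genT K q n).
Local Notation X := (@rowsym K q n).
Local Notation N := (@Nbar K q n).
Local Notation Lq := (@jucys_murphy K q n).
Implicit Types (la rho mu A B C : seq nat) (h g : H).

Lemma gq0 : q != 0. Proof. by case: gq. Qed.
Lemma gq1 : q - 1 != 0. Proof. by rewrite subr_eq0; case: gq. Qed.

Lemma part_sum_cat A B r : part_sum (A ++ B) r =
  if (r < size A)%N then part_sum A r else (sumn A + part_sum B (r - size A))%N.
Proof. by rewrite /part_sum take_cat; case: ifP => // _; rewrite sumn_cat. Qed.

Lemma absorbs_raise A C B (L M : nat) : sumn (A ++ L :: C ++ M.+1 :: B) = n ->
  absorbs q n (A ++ L :: C ++ M.+1 :: B) (A ++ L.+1 :: C ++ M :: B).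
Proof.
move=> Sn; apply: absorbs_sort => //.
- by rewrite -Sn !sumn_cat /= !sumn_cat /=; lia.
- exists (size A).+1; have F : ((size A).+1 < size A)%N = false by lia.
  rewrite !part_sum_cat F subSnn.
  by rewrite /part_sum /= !take0 /=; lia.
move=> r; rewrite !part_sum_cat; case: ifP => // lt; rewrite leq_add2l.
case: (r - size A)%N => // s; rewrite /part_sum /= addSnnS leq_add2l.
rewrite -/(part_sum (C ++ M.+1 :: B) s) -/(part_sum (C ++ M :: B) s) !part_sum_cat.
case: ifP => // _; rewrite -addnS leq_add2l.
by case: (s - size C)%N => // t; rewrite /part_sum /= addSn.
Qed.

(** The lower row has become the longer one; once it is swapped to the top, a single node has moved
    up. *)
Lemma absorbs_raise_next A B (L : nat) : sumn (A ++ L.+1 :: L.+1 :: B) = n ->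
  absorbs q n (A ++ L.+1 :: L.+1 :: B) (A ++ L :: L.+2 :: B).
Proof.
move=> Sn; apply: absorbs_swap => //; first by rewrite -Sn !sumn_cat /=; lia.
exact: (@absorbs_raise A [::]).
Qed.

Lemma breaks_split A L C M B i : i \in breaks (A ++ L :: C ++ M :: B) =
  [|| i \in breaks_from 0 A, (i == sumn A + L)%N, i \in breaks_from (sumn A + L) C,
      (i == sumn A + L + sumn C + M)%N | i \in breaks_from (sumn A + L + sumn C + M) B].
Proof.
by rewrite /breaks !breaks_from_cat add0n /= breaks_from_cat mem_cat inE mem_cat inE.
Qed.

Lemma notin_breaks_lt o B i : (i < o)%N -> i \notin breaks_from o B.
Proof. by move=> lt; apply/negP => /breaks_from_bound; lia. Qed.

Lemma notin_breaks_gt o B i : (o + sumn B < i)%N -> i \notin breaks_from o B.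
Proof. by move=> lt; apply/negP => /breaks_from_bound; lia. Qed.

Lemma breaks_not_last A i : i \notin breaks_from 0 A -> (0 < i)%N -> i != sumn A.
Proof.
case: A => [|a A] nA i0; first by rewrite /=; lia.
by apply: contra nA => /eqP->; have := breaks_from_last 0 a A; rewrite add0n.
Qed.

Lemma T_prod_comm i (F : nat -> nat) m :
  (forall k, (k < m)%N -> (i.+1 < F k)%N \/ ((F k).+1 < i)%N) ->
  T i * \prod_(0 <= k < m) T (F k) = \prod_(0 <= k < m) T (F k) * T i.
Proof.
move=> far; apply: comm_prod => k; rewrite mem_index_iota => /andP[_ /far[l|l]].
  exact: T_comm.
by rewrite -T_comm.
Qed.

Lemma scaled_comm h g i : h * T i = q *: h -> T i * g = g * T i ->
  h * g * T i = q *: (h * g).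
Proof. by move=> E1 E2; rewrite -mulrA -E2 mulrA E1 scalerAl. Qed.

(** The last entry of the upper row is joined to the lower row: by [ladder_sum], the sum over coset
    representatives makes the product symmetric for rows of lengths [L] and [L+2]. *)
Lemma garnir_next A B L : sumn (A ++ L.+1 :: L.+1 :: B) = n ->
  N (A ++ L.+1 :: L.+1 :: B) (X (A ++ L.+1 :: L.+1 :: B) *
     \sum_(0 <= x < L.+2) \prod_(0 <= k < x) T (sumn A + L.+1 + k)).
Proof.
move=> Sn; set la := A ++ _; set o := sumn A; pose b := (o + L.+1)%N.
have Eo : sumn A = o by []. have Eb : b = (o + L.+1)%N by [].
have Sn' : (o + (L.+1 + (L.+1 + sumn B)) = n)%N by rewrite -Sn sumn_cat.
have la_notin (i : nat) : i \notin breaks_from 0 A -> (i != b)%N -> (i != b + L.+1)%N ->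
    i \notin breaks_from (b + L.+1) B -> i \notin breaks la.
  move=> i1 i2 i3 i4; rewrite (@breaks_split A L.+1 [::]) /= addn0 !negb_or i1 -/o -/b.
  by rewrite i2 i3.
apply: absorbs_raise_next => // i lti.
rewrite (@breaks_split A L [::] L.+2) /= addn0 !negb_or -/o.
have -> : (o + L + L.+2 = b + L.+1)%N by lia.
move=> /and4P[iA ib ibL iB]; have io := breaks_not_last iA (proj1 (andP lti)); rewrite -/o in io.
case: (ltnP i b) => lib.
  apply: scaled_comm.
    apply: rowsym_T => //.
    by apply: la_notin => //; lia.
  by apply: comm_sum => x _; apply: T_prod_comm => k _; left; rewrite -/b; lia.
case: (ltnP i (b + L.+1)) => libL.
  have := @ladder_sum K q H (fun k => T (b + k)) L.+1 (X la) _ _ _ _ (i - b).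
  rewrite subnKC //; apply; last lia.
  - by move=> k ltk; apply: T_quad; lia.
  - by move=> k ltk; rewrite addnS; apply: T_braid; lia.
  - by move=> k m ltkm ltm; apply: T_comm; lia.
  move=> k ltk; apply: rowsym_T => //; first lia.
  by apply: la_notin; [apply: notin_breaks_gt|..|apply: notin_breaks_lt]; lia.
apply: scaled_comm.
  apply: rowsym_T => //; apply: la_notin => //; lia.
apply: comm_sum => x; rewrite mem_index_iota => ltx.
by apply: T_prod_comm => k ltk; right; rewrite -/b; lia.
Qed.

Section Descend.
Variables (A C B : seq nat) (L M : nat).
Let la := A ++ L :: C ++ M.+1 :: B.
Let o := sumn A.
Let b := (o + L)%N.
Let p := (b + sumn C)%N.
(** The product carries the first node of the row of length [M+1] up past all rows of [C], next to
    the end of the row of length [L]. *)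
Let y := X la * \prod_(0 <= k < sumn C) T (p - k).
Hypothesis Sn : sumn la = n.

Let Eo : sumn A = o. Proof. by []. Qed.
Let Eb : b = (o + L)%N. Proof. by []. Qed.
Let Ep : p = (b + sumn C)%N. Proof. by []. Qed.
Let Sn' : (p + (M.+1 + sumn B) = n)%N.
Proof. by rewrite -Sn /la /p /b /o !sumn_cat /= !sumn_cat /=; lia. Qed.

Let la_notin (i : nat) : i \notin breaks_from 0 A -> (i != b)%N -> i \notin breaks_from b C ->
  (i != p + M.+1)%N -> i \notin breaks_from (p + M.+1) B -> i \notin breaks la.
Proof.
move=> i1 i2 i3 i4 i5; rewrite /la breaks_split !negb_or i1 -/o -/b -/p.
by rewrite i2 i3 i4.
Qed.

Let y_low i : (0 < i < b)%N -> i \notin breaks_from 0 A -> y * T i = q *: y.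
Proof.
move=> lti iA; apply: scaled_comm.
  apply: rowsym_T => //; first lia.
  by apply: la_notin; [|lia|apply: notin_breaks_lt; lia|lia|apply: notin_breaks_lt; lia].
by apply: T_prod_comm => k ltk; left; lia.
Qed.

Lemma garnir_descend :
  N la (y * \sum_(0 <= x < L.+1) \prod_(0 <= k < x) T (b - k)).
Proof.
apply: absorbs_raise => // i lti.
rewrite breaks_split !negb_or -/o addnS -/b.
have -> : (b.+1 + sumn C + M = p + M.+1)%N by lia.
move=> /and5P[iA ib iC ipM iB].
have io := breaks_not_last iA (proj1 (andP lti)); rewrite -/o in io.
case: (ltnP i o) => lio.
  apply: scaled_comm; first by apply: y_low => //; lia.
  apply: comm_sum => x; rewrite mem_index_iota => ltx.
  by apply: T_prod_comm => k ltk; left; lia.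
case: (leqP i b) => lib.
  have := @ladder_sum K q H (fun k => T (b - k)) L y _ _ _ _ (b - i).
  rewrite subKn //; apply; last by lia.
  - by move=> k ltk; apply: T_quad; lia.
  - move=> k ltk; have -> : (b - k = (b - k.+1).+1)%N by lia.
    by symmetry; apply: T_braid; lia.
  - by move=> k m ltkm ltm; symmetry; apply: T_comm; lia.
  move=> k ltk; apply: y_low; first by lia.
  by apply: notin_breaks_gt; lia.
apply: scaled_comm; last first.
  apply: comm_sum => x; rewrite mem_index_iota => ltx.
  by apply: T_prod_comm => k ltk; right; lia.
have ipS : i != p.+1.
  case EC : C iC => [|c C'] iC; first by rewrite /p EC /=; lia.
  apply: contra iC => /eqP->; have := breaks_from_last b.+1 c C'.
  by rewrite -EC addSn.
case: (leqP i p) => lip.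
  (* The rows of [C] have been displaced by one entry, so a generator inside them passes the
     descending product with its index lowered by one. *)
  have := @ladder_shift K H (fun k => T (p - k)) (sumn C) _ _ (sumn C) (p - i).
  rewrite subKn // => sh; rewrite /y -mulrA sh; first last.
  - exact: leqnn.
  - lia.
  - by move=> k m ltkm ltm; symmetry; apply: T_comm; lia.
  - move=> k ltk; have -> : (p - k = (p - k.+1).+1)%N by lia.
    by symmetry; apply: T_braid; lia.
  have -> : (p - (p - i).+1 = i.-1)%N by lia.
  rewrite mulrA rowsym_T ?scalerAl //; first lia.
  apply: la_notin; [apply: notin_breaks_gt; lia|lia| |lia|apply: notin_breaks_lt; lia].
  by apply: contra iC => iC; rewrite breaks_fromS; apply/mapP; exists i.-1 => //; lia.
apply: scaled_comm; last by apply: T_prod_comm => k ltk; right; lia.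
apply: rowsym_T => //; apply: la_notin; [by []|lia|apply: notin_breaks_gt; lia|by []|by []].
Qed.

(** By the Garnir relation, the terms of positive length in the coset sum add up to [- y] modulo the
    ideal. Put into [ladder_fold] at [x = L], this leaves [q^(L+1) - (q-1) q^L = q^L], to be divided
    by the factor [q] present there. *)
Lemma descend_fold : N la
  (y * (\prod_(0 <= k < L) T (b - k)) * (\prod_(0 <= k < L) T (o + k).+1)
   - (q ^+ L / q) *: y).
Proof.
have -> : y * (\prod_(0 <= k < L) T (b - k)) * (\prod_(0 <= k < L) T (o + k).+1)
   - (q ^+ L / q) *: y = ((q - 1) * q ^+ L / q) *:
     (y * \sum_(0 <= x < L.+1) \prod_(0 <= k < x) T (b - k)); last first.
  by apply: Nbar_scale; apply: garnir_descend.
apply: (scalerI gq0); rewrite scalerBr.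
have -> : \prod_(0 <= k < L) T (o + k).+1 = \prod_(0 <= k < L) T (b - (L - k.+1)).
  by apply: eq_big_nat => k ltk; congr T; lia.
rewrite (@ladder_fold K q H (fun k => T (b - k)) L y _ _ _ _ L) //.
- rewrite [\sum_(0 <= x < L.+1) _]big_ltn // (big_geq (leqnn 0)) mulrDr mulr1 !scalerA [q * _]mulrC !divfK ?gq0 //.
  rewrite scalerDr -addrA addrC; congr (_ + _).
  by rewrite -scalerBl mulrCA mulfV ?gq0 // mulr1 exprS mulrBl mul1r.
- by move=> k ltk; apply: T_quad; lia.
- move=> k ltk; have -> : (b - k = (b - k.+1).+1)%N by lia.
  by symmetry; apply: T_braid; lia.
- by move=> k m ltkm ltm; symmetry; apply: T_comm; lia.
move=> k ltk; apply: y_low; first by lia.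
by apply: notin_breaks_gt; lia.
Qed.

End Descend.

Definition Nbar_cong la h g := N la (h - g).
Local Notation congN := Nbar_cong.

Lemma congN_refl la h : congN la h h.
Proof. by rewrite /Nbar_cong subrr; apply: Nbar0. Qed.

Lemma congN_sym la h g : congN la h g -> congN la g h.
Proof. by rewrite /Nbar_cong -[g - h]opprB; apply: Nbar_opp. Qed.

Lemma congN_trans la g h k : congN la h g -> congN la g k -> congN la h k.
Proof. by move=> E1 E2; have := Nbar_add E1 E2; rewrite addrA subrK. Qed.

Lemma congN_mulr la a h g : congN la h g -> congN la (h * a) (g * a).
Proof. by rewrite /Nbar_cong -mulrBl; apply: Nbar_mulr. Qed.

Lemma congN_scale la (a : K) h g : congN la h g -> congN la (a *: h) (a *: g).
Proof. by rewrite /Nbar_cong -scalerBr; apply: Nbar_scale. Qed.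

Lemma congN_add la h g h' g' : congN la h g -> congN la h' g' -> congN la (h + h') (g + g').
Proof. by rewrite /Nbar_cong opprD addrACA; apply: Nbar_add. Qed.

(** The induction peels off the top row of [C], whose letters form the innermost part of the
    palindrome, and hands it to the prefix [A]. A row of length [L] contributes [q^(L-1)], which
    accounts for the exponent [sumn C - size C]. *)
Lemma rowsym_JM C : forall A B M, sumn (A ++ C ++ M.+1 :: B) = n ->
  congN (A ++ C ++ M.+1 :: B)
    (X (A ++ C ++ M.+1 :: B) * (\prod_(0 <= k < sumn C) T (sumn A + sumn C - k))
       * \prod_(0 <= k < sumn C) T (sumn A + k).+1)
    ((q ^+ sumn C / q ^+ size C) *: X (A ++ C ++ M.+1 :: B)).
Proof.
elim: C => [|L C IH] A B M Sn.
  rewrite !(big_geq (leqnn 0)) !mulr1 /= expr0 divr1 scale1r; exact: congN_refl.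
have := IH (rcons A L) B M; rewrite !cat_rcons => /(_ Sn); rewrite -cat_rcons.
set la := rcons A L ++ _; have Ela : la = A ++ L :: C ++ M.+1 :: B by rewrite /la cat_rcons.
have -> : sumn (rcons A L) = (sumn A + L)%N by rewrite -cats1 sumn_cat /= addn0.
move=> {}IH; rewrite [sumn (_ :: _)]/= [size (_ :: _)]/=.
set o := sumn A; pose b := (o + L)%N; pose p := (b + sumn C)%N.
have -> : \prod_(0 <= k < L + sumn C) T (o + (L + sumn C) - k) =
    (\prod_(0 <= k < sumn C) T (p - k)) * \prod_(0 <= k < L) T (b - k).
  rewrite (@big_cat_nat _ _ _ (sumn C)) //=; last by rewrite leq_addl.
  rewrite addnA; congr (_ * _).
  rewrite -{1}[sumn C]add0n big_addn addnK; apply: eq_big_nat => k ltk; congr T.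
  by rewrite /p /b; lia.
have -> : \prod_(0 <= k < L + sumn C) T (o + k).+1 =
    (\prod_(0 <= k < L) T (o + k).+1) * \prod_(0 <= k < sumn C) T (b + k).+1.
  rewrite (@big_cat_nat _ _ _ L) //=; last by rewrite leq_addr.
  congr (_ * _).
  rewrite -{1}[L]add0n big_addn addKn; apply: eq_big_nat => k ltk; congr (T _.+1).
  by rewrite /b; lia.
have Sn' : sumn (A ++ L :: C ++ M.+1 :: B) = n := Sn.
have := descend_fold Sn'; rewrite -Ela -/o -/b -/p => D.
rewrite !mulrA; apply: congN_trans (congN_mulr _ D) _.
rewrite -scalerAl; apply: congN_trans (congN_scale _ IH) _.
rewrite scalerA exprD exprS invfM mulrACA; exact: congN_refl.
Qed.

Lemma qint_add1 (a : int) : q * qint q a + 1 = qint q (a + 1).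
Proof.
rewrite /qint expfzDr ?gq0 // expr1z; apply: (mulIf gq1).
rewrite mulrDl mul1r -mulrA !divfK ?gq1 //.
by rewrite mulrBr mulr1 mulrC addrA subrK.
Qed.

Lemma rowsym_Lq C B M k : sumn (C ++ M.+1 :: B) = n -> (k <= M)%N ->
  congN (C ++ M.+1 :: B) (X (C ++ M.+1 :: B) * Lq (sumn C + k).+1)
    (qint q (k%:Z - (size C)%:Z) *: X (C ++ M.+1 :: B)).
Proof.
move=> Sn; set la := C ++ _; set p := sumn C.
have Sn' : (p + (M.+1 + sumn B) = n)%N by rewrite -Sn sumn_cat.
elim: k => [_|k IH ltkM].
  have := @rowsym_JM C [::] B M Sn; rewrite /= -/la -/p => JM.
  have ltp : (p < n)%N by lia.
  (* Normalising by [q^(-p)] cancels [q^(sumn C)]. What remains is [q^(- size C)], the value of [1 +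
     (q-1)[- size C]]. *)
  have := congN_scale (q ^- p) JM; rewrite -mulrA scalerAr -(Lq_JM gq0 ltp) scalerA.
  rewrite mulrA mulVf ?expf_neq0 ?gq0 // mul1r addn0 => E.
  have {}E := congN_add E (congN_refl la (- X la)).
  have {E} := congN_scale (q - 1)^-1 E.
  rewrite mulrDr mulr1 addrAC subrr add0r -scalerAr scalerA mulVf ?gq1 // scale1r.
  rewrite -scaleN1r -scalerDl scalerA /qint sub0r -exprnN.
  by rewrite [_^-1 * _]mulrC.
have ltm : (0 < (p + k).+1 < n)%N by lia.
have XT : X la * T (p + k).+1 = q *: X la.
  apply: rowsym_T => //; apply: (@notin_breaks _ (size C)); rewrite /la !part_sum_cat.
  have F : ((size C).+1 < size C)%N = false by lia.
  by rewrite ltnn F subnn subSnn /part_sum /= !take0 /= -/p; lia.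
rewrite addnS (LqS ltm gq0) -scalerAr mulrDr !mulrA XT -!scalerAl -scalerDr scalerA mulVf ?gq0 // scale1r.
apply: congN_trans (congN_add (congN_mulr _ (IH (ltnW ltkM))) (congN_refl _ _)) _.
rewrite -scalerAl XT scalerA -{2}[X la]scale1r -scalerDl (mulrC _ q) qint_add1.
rewrite (_ : k.+1%:Z - _ = k%:Z - (size C)%:Z + 1); first exact: congN_refl.
by rewrite -addn1 PoszD addrAC.
Qed.

End Garnir.

(** * Seminormal vectors *)

Section Residues.
Variables (K : fieldType) (q : K).
Hypothesis gq : generic q.

Lemma generic_expf_neq1 m : (0 < m)%N -> q ^+ m != 1.
Proof.
case: gq => q0 q1 pos m0; have := pos (iota 0 m); rewrite -size_eq0 size_iota -lt0n => /(_ m0) s0.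
rewrite -subr_eq0 subrX1 mulf_neq0 ?subr_eq0 //.
by move: s0; rewrite -[m in iota 0 m]subn0 -/(index_iota 0 m) big_mkord.
Qed.

Lemma generic_expz_inj : injective (fun a : int => q ^ a).
Proof.
suff ge0 (m : nat) (b : int) : q ^ (b + m%:Z) = q ^ b -> m = 0%N.
  move=> a b E; have [le|le] := lerP a b.
    have Eb : b = a + `|b - a|%N%:Z by lia.
    by have := ge0 `|b - a|%N a; rewrite -Eb => /(_ (esym E)) E0; rewrite Eb E0 addr0.
  have Ea : a = b + `|a - b|%N%:Z by lia.
  by have := ge0 `|a - b|%N b; rewrite -Ea => /(_ E) E0; rewrite Ea E0 addr0.
rewrite expfzDr ?(gq0 gq) // -exprnP => E; apply/eqP; rewrite -leqn0 leqNgt.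
apply/negP => /generic_expf_neq1/eqP; apply.
by apply: (mulfI (expfz_neq0 b (gq0 gq))); rewrite E mulr1.
Qed.

Lemma qint_inj : injective (qint q).
Proof.
move=> a b; rewrite /qint => /(mulIf (invr_neq0 (gq1 gq)))/(addIr _).
exact: generic_expz_inj.
Qed.

Lemma qint0 : qint q 0 = 0.
Proof. by rewrite /qint expr0z subrr mul0r. Qed.

Lemma qint_neq0 a : a != 0 -> qint q a != 0.
Proof. by apply: contra => /eqP E; apply/eqP/qint_inj; rewrite E qint0. Qed.

Lemma qint_q1 a : (q - 1) * qint q a + 1 = q ^ a.
Proof. by rewrite /qint mulrC divfK ?(gq1 gq) // subrK. Qed.

Lemma qintB a b : qint q a - qint q b = q ^ b * qint q (a - b).
Proof.
rewrite /qint -mulrBl mulrA; congr (_ * _).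
by rewrite mulrBr mulr1 -expfzDr ?(gq0 gq) // [b + _]addrC subrK opprB addrA subrK.
Qed.

End Residues.

Section Contents.
Variable la : seq nat.

(** The argument is zero-based, standing for the entry [x+1]. The cancelling successors are kept so
    that [residue] in [rt] unfolds to this expression. *)
Definition content (x : nat) : int :=
  ((x - part_sum la (row_of la x)).+1)%:Z - ((row_of la x).+1)%:Z.

Lemma contentE r x : (part_sum la r <= x < part_sum la r.+1)%N ->
  content x = (x - part_sum la r)%N%:Z - r%:Z.
Proof. by move=> ltx; rewrite /content (row_of_uniq ltx); lia. Qed.

Lemma part_sumS r : part_sum la r.+1 = (part_sum la r + lam la r.+1)%N.
Proof.
rewrite /part_sum /lam /=; case: (ltnP r (size la)) => ltr.
  by rewrite (take_nth 0%N) // -cats1 sumn_cat /= addn0.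
by rewrite nth_default // addn0 !take_oversize // ltnW.
Qed.

Lemma lam_mono n r s : is_partition n la -> (0 < r <= s)%N -> (lam la s <= lam la r)%N.
Proof.
move=> /and3P[sla _ _] /andP[r0 lers]; rewrite /lam.
case: (ltnP s.-1 (size la)) => lts; last by rewrite [nth _ _ s.-1]nth_default.
have tr : transitive geq by move=> a b d /= l1 l2; apply: leq_trans l2 l1.
have := sorted_leq_nth tr leqnn 0%N sla; apply; rewrite ?inE; lia.
Qed.

Lemma part_sum_block r L h i : (forall i, (0 < i <= h)%N -> lam la (r + i) = L) ->
  (i <= h)%N -> part_sum la (r + i) = (part_sum la r + i * L)%N.
Proof.
move=> rowsL; elim: i => [|i IH] lti; first by rewrite mul0n !addn0.
rewrite addnS part_sumS IH ?(ltnW lti) // -addnS rowsL ?lti //.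
by rewrite mulSn addnAC addnA.
Qed.

Lemma content_row_end r : (0 < lam la r.+1)%N ->
  content (part_sum la r.+1).-1 = (lam la r.+1)%:Z - r.+1%:Z.
Proof. by move=> l0; rewrite (@contentE r) part_sumS; lia. Qed.

Section RemovableNode.
Variables (k l : nat).
Hypothesis rem_kl : removable la (k, l).
Let c := tla la (k, l).

Lemma kl_facts : [/\ (0 < k)%N, (k <= size la)%N, (0 < l)%N, l = lam la k & c = part_sum la k].
Proof.
have /and3P[/and4P[/= k0 lek l0 _] /eqP/= El _] := rem_kl; split=> //.
by rewrite /c /tla /= El -[k in RHS]prednK // part_sumS prednK.
Qed.

Lemma c_gt0 : (0 < c)%N.
Proof. by case: kl_facts => _ _ l0 _ _; rewrite /c /tla /=; lia. Qed.

Lemma part_sum_gt0 r : (k <= r)%N -> (0 < part_sum la r)%N.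
Proof.
case: kl_facts => _ _ _ _ Ec /(part_sum_le la); rewrite -Ec.
exact: leq_trans c_gt0.
Qed.

Definition corner_content : int := l%:Z - k%:Z.

Lemma content_c : content c.-1 = corner_content.
Proof.
case: kl_facts => k0 lek l0 El Ec; rewrite /corner_content (@contentE k.-1); last first.
  by rewrite (prednK k0) -Ec /c /tla /=; lia.
by rewrite /c /tla /=; lia.
Qed.

End RemovableNode.
End Contents.

Section Seminormal.
Variables (K : fieldType) (q : K) (n : nat).
Hypothesis gq : generic q.
Local Notation H := (heckeAlg q n).
Local Notation TT := (@basisT K q n).
Local Notation T := (@genT K q n).
Local Notation X := (@rowsym K q n).
Local Notation N := (@Nbar K q n).
Local Notation congN := (@Nbar_cong K q n).
Local Notation Lq := (@jucys_murphy K q n).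
Implicit Types (h g : H).
Variable la : seq nat.
Hypothesis Sn : sumn la = n.

Local Notation content := (content la).

Lemma rowsym_Lq_content m : (0 < m <= n)%N -> congN la (X la * Lq m) (qint q (content m.-1) *: X la).
Proof.
case: m => // x /= ltx; have ltx' : (x < sumn la)%N by rewrite Sn.
have [ltr /andP[l1 l2]] := row_ofP ltx'; set r := row_of la x in ltr l1 l2.
rewrite (@contentE la r) ?l1 //.
have Ela : la = take r la ++ nth 0%N la r :: drop r.+1 la.
  by rewrite -drop_nth // cat_take_drop.
have Er : part_sum la r.+1 = (part_sum la r + nth 0%N la r)%N.
  by rewrite /part_sum (take_nth 0%N) // -cats1 sumn_cat /= addn0.
case EM : (nth 0%N la r) Er Ela => [|M] Er Ela; first by lia.
have Sn' : sumn (take r la ++ M.+1 :: drop r.+1 la) = n by rewrite -Ela.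
have := @rowsym_Lq _ _ _ gq (take r la) (drop r.+1 la) M (x - part_sum la r) Sn'.
rewrite -Ela size_takel; last exact: ltnW.
rewrite -[sumn _]/(part_sum la r) subnKC //; apply.
by lia.
Qed.

Lemma congN_intertwine h d (a b : int) : (0 < d < n)%N -> a != b ->
  congN la (h * Lq d) (qint q a *: h) -> congN la (h * Lq d.+1) (qint q b *: h) ->
  let h' := h * (T d + (qint q (a - b))^-1 *: 1) in
  congN la (h' * Lq d) (qint q b *: h') /\ congN la (h' * Lq d.+1) (qint q a *: h').
Proof.
move=> ltd neab Ea Eb; set x := (qint q (a - b))^-1.
(* Since [[a] - [b] = q^b [a-b]], the constant [1/[a-b]] turns the gap between the eigenvalues into
   [q^b = (q-1)[b] + 1], exactly the inhomogeneous term of [T_Lq] and [T_LqS]. *)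
have xE : x * qint q a = x * qint q b + ((q - 1) * qint q b + 1).
  have <- : x * qint q a - x * qint q b = (q - 1) * qint q b + 1; last by rewrite addrC subrK.
  by rewrite qint_q1 // -mulrBr qintB // mulrCA mulVf ?mulr1 // qint_neq0 // subr_eq0.
have E1 : congN la (h * T d * Lq d.+1)
    (qint q a *: (h * T d) + ((q - 1) * qint q b + 1) *: h).
  have -> : h * T d * Lq d.+1 = h * Lq d * T d + ((q - 1) *: (h * Lq d.+1) + h).
    by rewrite -mulrA (T_LqS (gq0 gq) ltd) !mulrDr mulr1 mulrA -scalerAr.
  have -> : qint q a *: (h * T d) + ((q - 1) * qint q b + 1) *: h =
      qint q a *: h * T d + ((q - 1) *: (qint q b *: h) + h).
    by rewrite scalerA scalerDl scale1r scalerAl.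
  exact: congN_add (congN_mulr _ Ea) (congN_add (congN_scale _ Eb) (congN_refl _ _)).
have E2 : congN la (h * T d * Lq d)
    (qint q b *: (h * T d) - ((q - 1) * qint q b + 1) *: h).
  have -> : h * T d * Lq d = h * Lq d.+1 * T d + (-1) *: ((q - 1) *: (h * Lq d.+1) + h).
    by rewrite -mulrA (T_Lq (gq0 gq) ltd) mulrBr !mulrDr mulr1 mulrA -scalerAr scaleN1r.
  have -> : qint q b *: (h * T d) - ((q - 1) * qint q b + 1) *: h =
      qint q b *: h * T d + (-1) *: ((q - 1) *: (qint q b *: h) + h).
    by rewrite scalerA scalerDl scale1r scalerAl scaleN1r.
  exact: congN_add (congN_mulr _ Eb) (congN_scale _ (congN_add (congN_scale _ Eb) (congN_refl _ _))).
rewrite /= mulrDr -scalerAr mulr1 !mulrDl -!scalerAl !scalerDr !scalerA; split.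
  apply: congN_trans (congN_add E2 (congN_scale x Ea)) _.
  rewrite scalerA xE [qint q b * x]mulrC [(x * _ + _) *: h]scalerDl addrACA addNr addr0.
  exact: congN_refl.
apply: congN_trans (congN_add E1 (congN_scale x Eb)) _.
rewrite scalerA [qint q a * x]mulrC xE -addrA -scalerDl [_ + x * _]addrC; exact: congN_refl.
Qed.

Variables (k l : nat).
Hypothesis pla : is_partition n la.
Hypothesis rem_kl : removable la (k, l).
Let c := tla la (k, l).
Local Notation corner_content := (corner_content k l).


Lemma c_le : (c <= n)%N.
Proof.
case: (kl_facts rem_kl) => _ lek _ _ Ec; rewrite /c Ec -Sn -(part_sum_full (leqnn (size la))).
exact: part_sum_le.
Qed.

(** Entries after [c] lie in rows below [k], hence in columns up to [l] only. The strict inequality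
    makes every denominator nonzero and separates the residue of the corner from those of later
    entries. *)
Lemma content_lt i : (c <= i < n)%N -> content i < corner_content.
Proof.
case: (kl_facts rem_kl) => k0 lek l0 El Ec /andP[leci ltin]; rewrite -/c in Ec.
have lti : (i < sumn la)%N by rewrite Sn.
have [ltr /andP[l1 l2]] := row_ofP lti; rewrite (@contentE la (row_of la i)) ?l1 //.
set r := row_of la i in ltr l1 l2 *.
have lekr : (k <= r)%N.
  rewrite leqNgt; apply/negP => lt; have := part_sum_le la lt; rewrite -Ec; lia.
have := lam_mono (r := k) (s := r.+1) pla; rewrite k0 -El ltnW // => /(_ isT).
by move: l2; rewrite part_sumS /corner_content; lia.
Qed.

Definition axial i : int := corner_content - content i.
Definition seminormal_prod d : H := X la * \prod_(c <= i < d) (T i + (qint q (axial i))^-1 *: 1).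

Local Notation fv := seminormal_prod.

(* The content of the node holding [m] in [t^lambda sigma_(c,d)]. *)
Definition content_at d m : int :=
  if (m < c)%N then content m.-1 else if (m < d)%N then content m
  else if m == d then corner_content else content m.-1.

Lemma axial_gt0 i : (c <= i < n)%N -> 0 < axial i.
Proof. by move=> /content_lt; rewrite /axial subr_gt0. Qed.

Lemma fvS d : (c <= d)%N -> fv d.+1 = fv d * (T d + (qint q (axial d))^-1 *: 1).
Proof. by move=> le; rewrite /seminormal_prod big_nat_recr //= mulrA. Qed.

(** Each new factor exchanges the eigenvalues at [d] and [d+1]: the content of the corner travels
    upwards, and each content it overtakes drops back by one place. *)
Lemma fv_Lq d m : (c <= d <= n)%N -> (0 < m <= n)%N ->
  congN la (fv d * Lq m) (qint q (content_at d m) *: fv d).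
Proof.
have c0 := c_gt0 rem_kl.
move=> /andP[lecd]; rewrite -(subnKC lecd); elim: (d - c)%N m => {d lecd} [|t IH] m lecn ltm.
  rewrite addn0 /seminormal_prod big_geq // mulr1; have := rowsym_Lq_content ltm; rewrite /content_at.
  by case: ltngtP => // ->; rewrite (content_c rem_kl).
rewrite addnS in lecn *; set d := (c + t)%N in IH lecn *.
have lecd : (c <= d)%N by rewrite leq_addr.
have ltd : (0 < d < n)%N by lia.
rewrite fvS //.
have Ed := IH d (ltnW lecn); have EdS := IH d.+1 (ltnW lecn).
have scd : content_at d d = corner_content by rewrite /content_at ltnn eqxx ltnNge lecd.
have scdS : content_at d d.+1 = content d by rewrite /content_at ltnNge ltnW // ltnNge leqnSn /= ifF //; lia.
rewrite scd in Ed; rewrite scdS in EdS.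
have ne : corner_content != content d.
  by have := @content_lt d; rewrite lecd /= => /(_ lecn); case: ltgtP.
have [| |I1 I2] := @congN_intertwine _ d _ _ ltd ne (Ed _) (EdS _); try lia.
have [->|nd] := eqVneq m d.
  by rewrite /content_at ltnNge lecd /= ltnSn; exact: I1.
have [->|ndS] := eqVneq m d.+1.
  by rewrite /content_at ltnNge ltnW // ltnn eqxx; exact: I2.
have Tm : T d * Lq m = Lq m * T d.
  by case: (ltnP m d) => lt; [apply: T_Lq_gt|apply: T_Lq_lt]; rewrite ?(gq0 gq) //; lia.
have -> : content_at d.+1 m = content_at d m.
  rewrite /content_at; case: (m < c)%N => //.
  by case: (ltnP m d) => lt; [rewrite ifT //|rewrite ifF ?(negPf nd) ?(negPf ndS)]; lia.
have C : (T d + (qint q (axial d))^-1 *: 1) * Lq m = Lq m * (T d + (qint q (axial d))^-1 *: 1).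
  by rewrite mulrDl mulrDr Tm -scalerAl -scalerAr mul1r mulr1.
by rewrite -mulrA C mulrA scalerAl; apply: congN_mulr; apply: IH => //; apply: ltnW.
Qed.

End Seminormal.

(** * Action of the product [Et] on eigenvectors *)

Section Idempotent.
Variables (K : fieldType) (q : K) (n : nat).
Hypothesis gq : generic q.
Local Notation H := (heckeAlg q n).
Local Notation TT := (@basisT K q n).
Local Notation T := (@genT K q n).
Local Notation X := (@rowsym K q n).
Local Notation N := (@Nbar K q n).
Local Notation congN := (@Nbar_cong K q n).
Local Notation Lq := (@jucys_murphy K q n).
Implicit Types (h g : H).
Variable la : seq nat.

Lemma mem_parts_le f m b s : sorted geq s -> all (fun x => 0 < x)%N s -> sumn s = m ->
  all (fun x => x <= b)%N s -> (m <= f)%N -> s \in parts_le f m b.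
Proof.
elim: f m b s => [|f IH] m b [|x s] ss ps Es bs lemf.
- by rewrite /= -Es.
- by move: ps lemf; rewrite -Es /=; lia.
- by rewrite /= -Es.
have /andP[x0 ps'] := ps; have /andP[xb bs'] := bs.
have Em : (m == 0)%N = false by rewrite -Es /=; lia.
rewrite /= Em; apply/flattenP; exists [seq x :: t | t <- parts_le f (m - x) x].
  apply/mapP; exists x => //; rewrite mem_iota add1n ltnS leq_min.
  by rewrite x0 xb -Es /= leq_addr.
apply/mapP; exists s => //; apply: IH => //; first exact: path_sorted ss.
- by rewrite -Es /= addKn.
- by apply: order_path_min ss => a c d /= l1 l2; apply: leq_trans l2 l1.
by move: lemf; rewrite -Es /=; lia.
Qed.

Lemma mem_partitions : is_partition n la -> la \in partitions n.
Proof.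
move=> pla; rewrite mem_filter pla /=; have /and3P[sla ala /eqP Sla] := pla.
apply: mem_parts_le => //; apply/allP => x xla; rewrite -Sla.
by rewrite (perm_sumn (perm_to_rem xla)) /= leq_addr.
Qed.

(** Guarantees that the factor at the residue of the corner really occurs in [Et] for every entry
    whose own residue is different. *)
Lemma mem_Rset rc : is_partition n la -> in_diagram la rc -> residue q rc \in Rset q n.
Proof.
move=> pla; case: rc => r c /and4P[/= r0 ler c0 lec]; rewrite mem_undup.
apply/flattenP; exists [seq residue q rc | rc <- nodes la].
  by apply/mapP; exists la => //; apply: mem_partitions.
apply/mapP; exists (r, c) => //; apply/flattenP.
exists [seq (r.-1.+1, c'.+1) | c' <- iota 0 (nth 0%N la r.-1)].
  apply/mapP; exists r.-1 => //; rewrite mem_iota /=; lia.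
apply/mapP; exists c.-1; last by rewrite !prednK.
by rewrite mem_iota /=; move: lec; rewrite /lam /=; lia.
Qed.

Definition Efactor (d : 'S_n) (m : nat) (a : K) : H := (rt q la d m - a)^-1 *: (Lq m - a *: 1).

Lemma EtE d : Et q la d =
  \prod_(1 <= m < n.+1) \prod_(a <- Rset q n | a != rt q la d m) Efactor d m a.
Proof. by rewrite /Et -hecke_mulE. Qed.

Lemma congN_prod (I : eqType) (r : seq I) (P : pred I) (F : I -> H) h :
  (forall i, i \in r -> P i -> congN la (h * F i) h) ->
  congN la (h * \prod_(i <- r | P i) F i) h.
Proof.
elim: r => [|i r IH] E; first by rewrite big_nil mulr1; apply: congN_refl.
have Er : congN la (h * \prod_(j <- r | P j) F j) h.
  by apply: IH => j jr; apply: E; rewrite inE jr orbT.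
rewrite big_cons; case: ifP => // Pi; rewrite mulrA.
by apply: congN_trans Er; apply: congN_mulr; apply: E; rewrite ?mem_head.
Qed.

Lemma comm_prod_cond (I : eqType) (r : seq I) (P : pred I) (F : I -> H) x :
  (forall i, i \in r -> x * F i = F i * x) ->
  x * (\prod_(i <- r | P i) F i) = (\prod_(i <- r | P i) F i) * x.
Proof.
move=> E; rewrite -big_filter; apply: comm_prod => i.
by rewrite mem_filter => /andP[_ /E].
Qed.

(** Every factor commutes with [F i0], so the factor that sends [h] into the ideal can be brought to
    the front. *)
Lemma Nbar_prod (I : eqType) (r : seq I) (P : pred I) (F : I -> H) h i0 :
  i0 \in r -> P i0 -> (forall i, i \in r -> F i * F i0 = F i0 * F i) ->
  N la (h * F i0) -> N la (h * \prod_(i <- r | P i) F i).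
Proof.
move=> i0r Pi0; elim: r h i0r => // i r IH h i0r comm Nh.
rewrite big_cons; have [Ei|ne] := eqVneq i i0.
  by rewrite Ei Pi0 mulrA; apply: Nbar_mulr.
have i0r' : i0 \in r by move: i0r; rewrite inE eq_sym (negPf ne).
have comm' j : j \in r -> F j * F i0 = F i0 * F j.
  by move=> jr; apply: comm; rewrite inE jr orbT.
case: ifP => Pi; last exact: IH.
rewrite mulrA; apply: IH => //.
by rewrite -mulrA comm ?mem_head // mulrA; apply: Nbar_mulr.
Qed.

Lemma Efactor_comm d m m' a a' : (0 < m <= n)%N -> (0 < m' <= n)%N ->
  Efactor d m a * Efactor d m' a' = Efactor d m' a' * Efactor d m a.
Proof.
move=> ltm ltm'; rewrite /Efactor -!scalerAl -!scalerAr !scalerA [_ * _^-1]mulrC.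
congr (_ *: _); rewrite !mulrBl !mulrBr -!scalerAl -!scalerAr !mul1r !mulr1.
rewrite (Lq_comm (gq0 gq) ltm ltm') !opprB !scalerA (mulrC a).
by rewrite [LHS]addrACA [RHS]addrACA [- (a' *: _) + _]addrC.
Qed.

Lemma congN_Et d h : (forall m, (0 < m <= n)%N -> congN la (h * Lq m) (rt q la d m *: h)) ->
  congN la (h * (Et q la d : H)) h.
Proof.
move=> E; rewrite EtE; apply: congN_prod => m; rewrite mem_index_iota ltnS => ltm _.
apply: congN_prod => a _ ne; rewrite /Efactor -scalerAr mulrBr -scalerAr mulr1.
have nz : rt q la d m - a != 0 by rewrite subr_eq0 eq_sym.
have := congN_scale (rt q la d m - a)^-1 (congN_add (E m ltm) (congN_refl _ (- (a *: h)))).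
by rewrite -scalerBl scalerA mulVf // scale1r.
Qed.

Lemma Nbar_Et d h m a : (0 < m <= n)%N -> a \in Rset q n -> a != rt q la d m ->
  congN la (h * Lq m) (a *: h) -> N la (h * (Et q la d : H)).
Proof.
move=> ltm aR ne E; rewrite EtE; apply: (Nbar_prod (i0 := m)) => //.
- by rewrite mem_index_iota.
- move=> m'; rewrite mem_index_iota => ltm'.
  apply: comm_prod_cond => a1 _; symmetry.
  by apply: comm_prod_cond => a2 _; apply: Efactor_comm.
apply: (Nbar_prod (i0 := a)) => //; first by move=> a' _; apply: Efactor_comm.
rewrite /Efactor -scalerAr mulrBr -scalerAr mulr1; apply: Nbar_scale.
exact: E.
Qed.

End Idempotent.

Section SeminormalVector.
Variables (K : fieldType) (q : K) (n : nat).
Hypothesis gq : generic q.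
Local Notation H := (heckeAlg q n).
Local Notation TT := (@basisT K q n).
Local Notation T := (@genT K q n).
Local Notation X := (@rowsym K q n).
Local Notation N := (@Nbar K q n).
Local Notation congN := (@Nbar_cong K q n).
Local Notation Lq := (@jucys_murphy K q n).
Variables (la : seq nat) (k l : nat).
Hypothesis pla : is_partition n la.
Hypothesis rem_kl : removable la (k, l).
Let c := tla la (k, l).
Let Sn : sumn la = n. Proof. by have /and3P[_ _ /eqP] := pla. Qed.
Let c0 : (0 < c)%N. Proof. exact: c_gt0 rem_kl. Qed.
Let cn : (c <= n)%N. Proof. exact: (c_le Sn rem_kl). Qed.

Lemma rt_sig m : (0 < m <= n)%N -> rt q la (sig n c n) m = qint q (content_at la k l n m).
Proof.
move=> /andP[m0 lemn]; rewrite /rt.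
have ltm : (m.-1 < n)%N by lia.
have -> : insub m.-1 = Some (Ordinal ltm) :> option 'I_n by exact: insubT.
set y := (sig n c n)^-1%g (Ordinal ltm).
have res : residue q ((row_of la y).+1, (y - part_sum la (row_of la y)).+1) = qint q (content la y).
  by rewrite /residue /content.
rewrite /= -/y res; congr (qint q _); rewrite /content_at -/c.
have yE (z : 'I_n) : sig n c n z = m.-1 :> nat -> y = z.
  by move=> E; apply: (@perm_inj _ (sig n c n)); rewrite permKV; apply: val_inj.
case: ifP => mc.
  by rewrite (yE (Ordinal ltm)) // sig_low //=; lia.
case: ifP => mn.
  by rewrite (yE (Ordinal mn)) // (sig_mid (x := Ordinal mn)) //=; lia.
have ltc : (c.-1 < n)%N by lia.
have -> : m = n by lia.
rewrite eqxx (yE (Ordinal ltc)) /=; first exact: content_c rem_kl.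
by rewrite (@sig_start n c n) //= ?c0 ?cn //; lia.
Qed.

Local Notation E := (Et q la (sig n c n) : H).
Local Notation fv := (@seminormal_prod K q n la k l).

Lemma corner_content_Rset : qint q (corner_content k l) \in Rset q n.
Proof. by have /andP[din _] := rem_kl; exact: (mem_Rset q pla din). Qed.

(** The tail of letters after [d] commutes with [L_d], so the error of one replacement still has the
    residue of the corner as its [L_d]-eigenvalue. In the final tableau the entry [d] has strictly
    smaller content, so the corresponding factor is present. *)
Lemma fv_T_tail d : (c <= d <= n)%N ->
  N la ((fv d * (\prod_(d <= i < n) T i) - fv n) * E).
Proof.
move=> /andP[lecd ledn]; rewrite -(subKn ledn).
have : (n - d <= n - c)%N by lia.
elim: (n - d)%N => {d lecd ledn} [|t IH] let_.
  by rewrite subn0 big_geq // mulr1 subrr mul0r; apply: Nbar0.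
set d := (n - t.+1)%N; have Ed : (n - t = d.+1)%N by rewrite /d; lia.
have {}IH := IH (ltnW let_); rewrite Ed in IH.
have lecd : (c <= d < n)%N by rewrite /d; lia.
rewrite big_ltn; last by rewrite /d; lia.
set P := \prod_(_ <= i < n) T i in IH *.
have -> : (fv d * (T d * P) - fv n) * E = (fv d.+1 * P - fv n) * E
    - (qint q (axial la k l d))^-1 *: (fv d * P * E).
  rewrite fvS; last by case/andP: lecd.
  rewrite mulrDr -scalerAr mulr1 !mulrDl mulrA -!scalerAl !mulNr.
  by rewrite [X in _ = X]addrAC addrK.
apply: Nbar_sub => //; apply: Nbar_scale.
apply: (Nbar_Et gq (m := d) (a := qint q (corner_content k l))).
- by lia.
- exact: corner_content_Rset.
- rewrite rt_sig; last lia.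
  rewrite (inj_eq (qint_inj gq)) /content_at -/c ltnNge (proj1 (andP lecd)) (proj2 (andP lecd)) /=.
  by have := content_lt Sn pla rem_kl lecd; case: ltgtP.
have PL : Lq d * P = P * Lq d.
  apply: comm_prod => i; rewrite mem_index_iota => lti.
  by rewrite (T_Lq_gt (gq0 gq)) //; lia.
rewrite -mulrA -PL mulrA scalerAl; apply: congN_mulr.
have scd : content_at la k l d d = corner_content k l.
  by rewrite /content_at -/c ltnn eqxx ltnNge (proj1 (andP lecd)).
by have := fv_Lq gq Sn pla rem_kl (d := d) (m := d); rewrite scd; apply; lia.
Qed.

Lemma f_n_fv : congN la (f_n q n la k l : H) (fv n).
Proof.
have Ef : (f_n q n la k l : H) = X la * TT (sig n c n) * E.
  rewrite /f_n /fT /eT -[cc _ _ _ _]/c.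
  by rewrite !mulHE.
rewrite Ef TT_sig //.
have fvc : fv c = X la by rewrite /seminormal_prod big_geq // mulr1.
have := @fv_T_tail c; rewrite leqnn cn fvc => /(_ isT); rewrite mulrBl => D.
apply: congN_trans D _; apply: congN_Et => m ltm.
by rewrite rt_sig //; apply: (fv_Lq gq Sn pla rem_kl) => //; rewrite cn leqnn.
Qed.

End SeminormalVector.

(** * Blocks of rows of equal length *)

Section Blocks.
Variables (K : fieldType) (q : K) (n : nat).
Hypothesis gq : generic q.
Local Notation H := (heckeAlg q n).
Local Notation TT := (@basisT K q n).
Local Notation T := (@genT K q n).
Local Notation X := (@rowsym K q n).
Local Notation N := (@Nbar K q n).
Local Notation congN := (@Nbar_cong K q n).

Lemma row_product (f : H) (a : nat) (r : nat -> int) j : (a < j)%N ->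
  (forall i, (a < i < j)%N -> f * T i = q *: f) ->
  (forall i, (a <= i < j)%N -> r i != 0) ->
  (forall i, (a <= i)%N -> (i.+1 < j)%N -> r i = r i.+1 + 1) ->
  f * \prod_(a <= i < j) (T i + (qint q (r i))^-1 *: 1) =
  f * (\prod_(a <= i < j) T i
       + (qint q (r j.-1))^-1 *: \sum_(a <= x < j) \prod_(a <= i < x) T i).
Proof.
elim: j => // j IH; rewrite ltnS leq_eqVlt => /orP[/eqP<-|ltaj] fT r0 rS.
  by rewrite !big_nat1 big_geq.
have {}IH : f * \prod_(a <= i < j) (T i + (qint q (r i))^-1 *: 1) =
  f * (\prod_(a <= i < j) T i
       + (qint q (r j.-1))^-1 *: \sum_(a <= x < j) \prod_(a <= i < x) T i).
  apply: IH => // i lti; [apply: fT|apply: r0|move=> ltij; apply: rS]; lia.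
have leaj := ltnW ltaj.
rewrite big_nat_recr //= mulrA IH [\prod_(a <= i < j.+1) T i]big_nat_recr //=.
rewrite [\sum_(a <= x < j.+1) _]big_nat_recr //=.
set P := \prod_(a <= i < j) T i; set S := \sum_(a <= x < j) _.
(* The letters of [S] have index at most [j - 2], so [T j] reaches [f]. *)
have fST : f * S * T j = q *: (f * S).
  apply: scaled_comm; first by apply: fT; rewrite ltaj ltnSn.
  apply: comm_sum => x; rewrite mem_index_iota => ltx.
  apply: comm_prod => i; rewrite mem_index_iota => lti.
  by rewrite -T_comm //; lia.
have rj0 : qint q (r j) != 0 by apply: qint_neq0 => //; apply: r0; rewrite leaj ltnSn.
have rj1 : qint q (r j.-1) != 0 by apply: qint_neq0 => //; apply: r0; lia.
have rE : (qint q (r j.-1))^-1 * (q + (qint q (r j))^-1) = (qint q (r j))^-1.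
  have -> : q + (qint q (r j))^-1 = (q * qint q (r j) + 1) / qint q (r j).
    by rewrite mulrDl mulfK // mul1r.
  have rj : r j.-1 = r j + 1 by have := rS j.-1; rewrite prednK; [apply; lia|lia].
  by rewrite (qint_add1 gq) -rj mulKf.
rewrite mulrDr -scalerAr mulr1 !mulrDr -!scalerAr mulrDl -scalerAl fST !mulrDr mulrA.
rewrite !scalerDr !scalerA -addrA [_ *: (f * S) + _]addrCA -scalerDl; congr (_ + _).
by rewrite [(_ / _)]mulrC -mulrDr rE addrC.
Qed.

(** The hypothesis is [q [r] + 1 = [r+1]] for [y = 1/[r]] and [z = 1/[r+1]]. The expansion exhibits
    the next step of the recursion for [phi], with [y F (P + R)] as the only defect. *)
Lemma block_expand (S F P R : H) (y z : K) : z * y + z * q = y ->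
  (S + y *: F) * (P + z *: R) = S * P + z *: ((S - q *: F) * R) + y *: (F * (P + R)).
Proof.
move=> yz; rewrite mulrDl !mulrDr mulrBl scalerBr -!scalerAl -!scalerAr !scalerA scalerDr.
have -> : y *: (F * R) = (y * z) *: (F * R) + (z * q) *: (F * R).
  by rewrite -scalerDl (mulrC y) yz.
set w := (z * q) *: _; rewrite [y *: (F * P) + (_ + w)]addrA [S * P + (_ - w)]addrA.
by rewrite [RHS]addrACA addNr addr0.
Qed.

Variables (la : seq nat) (k l : nat).
Hypothesis pla : is_partition n la.
Hypothesis rem_kl : removable la (k, l).
Let c := tla la (k, l).
Let Sn : sumn la = n. Proof. by have /and3P[_ _ /eqP] := pla. Qed.
Local Notation fv := (@seminormal_prod K q n la k l).

Lemma part_sum_le_n r : (part_sum la r <= n)%N.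
Proof.
rewrite -Sn -(part_sum_full (leq_maxl (size la) r)); apply: part_sum_le.
exact: leq_maxr.
Qed.

Lemma Rrow_prod r : (0 < r)%N -> (0 < part_sum la r.-1)%N ->
  (Rrow K n la r : H) =
    \sum_(part_sum la r.-1 <= x < part_sum la r) \prod_(part_sum la r.-1 <= i < x) T i.
Proof.
move=> r0 a0; rewrite /Rrow /aa /bb; apply: eq_big_nat => x ltx.
have := part_sum_le_n r => le.
by rewrite -[LHS]/(TT (sig n (part_sum la r.-1) x)) TT_sig //; lia.
Qed.

Lemma fv_c_row d i : (c <= d)%N -> (d < i < n)%N -> i \notin breaks la ->
  fv d * T i = q *: fv d.
Proof.
move=> lecd lti nb; apply: scaled_comm; first by apply: rowsym_T => //; lia.
apply: comm_prod => m; rewrite mem_index_iota => ltm.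
by rewrite mulrDr mulrDl -scalerAr -scalerAl mulr1 mul1r -T_comm //; lia.
Qed.

Lemma row_fv r : (k < r)%N -> (part_sum la r.-1 < part_sum la r)%N ->
  fv (part_sum la r) = fv (part_sum la r.-1) *
    (\prod_(part_sum la r.-1 <= i < part_sum la r) T i
     + (qint q (axial la k l (part_sum la r).-1))^-1 *: (Rrow K n la r : H)).
Proof.
move=> ltkr ltab; set a := part_sum la r.-1; set b := part_sum la r.
have [k0 lek l0 El Ec] := kl_facts rem_kl.
have leca : (c <= a)%N by rewrite /c Ec; apply: part_sum_le; lia.
have lebn : (b <= n)%N := part_sum_le_n r.
have c0 : (0 < c)%N := c_gt0 rem_kl.
have Er : r = r.-1.+1 by lia.
have row_content i : (a <= i < b)%N -> content la i = (i - a)%N%:Z - r.-1%:Z.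
  by move=> lti; apply: contentE; rewrite -Er.
rewrite Rrow_prod; [|lia|by apply: leq_trans c0 leca].
rewrite -row_product //.
- by rewrite /seminormal_prod -mulrA -big_cat_nat //= ltnW.
- move=> i lti; apply: fv_c_row => //; first by rewrite (proj1 (andP lti)) (leq_trans _ lebn) //; lia.
  by apply: (@notin_breaks _ r.-1); rewrite -Er.
- move=> i lti; have := @axial_gt0 n la Sn k l pla rem_kl i; rewrite -/c.
  by case: ltgtP => //; lia.
move=> i leai ltib; rewrite /axial !row_content; lia.
Qed.

Lemma garnir_row r L : (0 < r < size la)%N -> lam la r = L.+1 -> lam la r.+1 = L.+1 ->
  N la (X la * \sum_(part_sum la r <= x < part_sum la r + L.+2)
                  \prod_(part_sum la r <= i < x) T i).
Proof.
case: r => // r ltr E1 E2; set b := part_sum la r.+1.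
have Ela : la = take r la ++ L.+1 :: L.+1 :: drop r.+2 la.
  rewrite -{1}[la](cat_take_drop r); congr (_ ++ _).
  rewrite (drop_nth 0%N) ?(drop_nth 0%N (n := r.+1)) //; last exact: ltnW.
  by congr (_ :: _ :: _); [exact: E1|exact: E2].
have Eb : b = (sumn (take r la) + L.+1)%N by rewrite /b part_sumS E1.
have Sn' : sumn (take r la ++ L.+1 :: L.+1 :: drop r.+2 la) = n by rewrite -Ela.
have := garnir_next gq Sn'; rewrite -Ela -Eb.
suff -> : \sum_(b <= x < b + L.+2) \prod_(b <= i < x) T i =
    \sum_(0 <= x < L.+2) \prod_(0 <= k < x) T (b + k) by [].
rewrite -{1}[b]add0n big_addn addKn; apply: eq_bigr => x _.
rewrite -{1}[b]add0n big_addn addnK; apply: eq_bigr => i _.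
by rewrite addnC.
Qed.

(** * The rows of common length between two consecutive removable nodes *)

Section OneBlock.
Variables (j L : nat).
Let kj := kk la k l j.
Let h := (kk la k l j.+1 - kj)%N.
Let bi i := (part_sum la kj + i * L.+1)%N.
Hypothesis cj : cc la k l j = part_sum la kj.
Hypothesis lekj : (k <= kj)%N.
Hypothesis lekjS : (kk la k l j.+1 <= size la)%N.
Hypothesis llj : ll la k l j.+1 = L.+1.
Hypothesis rowsL : forall i, (0 < i <= h)%N -> lam la (kj + i) = L.+1.

Let ps_bi i (lei : (i <= h)%N) : part_sum la (kj + i) = bi i := part_sum_block rowsL lei.

Let axial_end i : (0 < i <= h)%N ->
  axial la k l (bi i).-1 = corner_content k l - (L.+1%:Z - (kj + i)%N%:Z).
Proof.
case: i => // i lti; rewrite -ps_bi ?(proj2 (andP lti)) // -(rowsL lti) addnS.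
by rewrite /axial content_row_end // -addnS rowsL.
Qed.

Local Notation phi i := (phi q n la k l j i : H).

Let bi_gt0 i : (0 < bi i)%N.
Proof. exact: leq_trans (part_sum_gt0 rem_kl lekj) (leq_addr _ _). Qed.

Lemma Rrow_block i : (i < h)%N -> (Rrow K n la (kj + i.+1) : H) =
  \sum_(bi i <= x < bi i.+1) \prod_(bi i <= m < x) T m.
Proof.
move=> lti; rewrite Rrow_prod addnS //=; first by rewrite -addnS !ps_bi // ltnW.
by rewrite ps_bi ?bi_gt0 // ltnW.
Qed.

Lemma Rrow_T i m : (i < h)%N -> (bi i.+1 <= m)%N ->
  T m * (Rrow K n la (kj + i.+1) : H) = (Rrow K n la (kj + i.+1) : H) * T m.
Proof.
move=> lti lem; rewrite Rrow_block //; apply: comm_sum => x; rewrite mem_index_iota => ltx.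
apply: comm_prod => y; rewrite mem_index_iota => lty; rewrite -T_comm //; lia.
Qed.

Lemma bi_le_n i : (i <= h)%N -> (bi i <= n)%N.
Proof. by move=> /ps_bi <-; apply: part_sum_le_n. Qed.

Lemma phi1 : phi 1 = Rrow K n la (kj + 1).
Proof. by []. Qed.

Lemma phiS i : (0 < i <= h)%N ->
  phi i.+1 = (\prod_(bi 0 <= m < bi i) T m - q *: phi i) * (Rrow K n la (kj + i.+1) : H).
Proof.
case: i => // i lti; rewrite -TT_sig ?bi_gt0 ?bi_le_n // mulHE.
by rewrite {1}/bi mul0n addn0 /bi -llj -cj.
Qed.

(** Only generators of index at most [bi i - 2] occur in [phi i]. *)
Lemma phi_T i m : (0 < i <= h)%N -> (bi i <= m)%N -> T m * phi i = phi i * T m.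
Proof.
elim: i => // i IH lti lem; case: (posnP i) => [i0|i0].
  rewrite i0 in lti lem *; rewrite phi1; apply: (@Rrow_T 0) => //.
rewrite phiS ?i0 ?(ltnW (proj2 (andP lti))) //; apply: comm_M; last exact: Rrow_T.
have lt : (bi i < m)%N by apply: leq_trans lem; rewrite /bi mulSn; lia.
apply: comm_D.
  by apply: comm_prod => y; rewrite mem_index_iota => lty; rewrite -T_comm //; lia.
rewrite -scaleNr; apply: comm_scale; apply: IH; last exact: ltnW.
by rewrite i0 ltnW // (proj2 (andP lti)).
Qed.

Lemma block_fv i : (0 < i <= h)%N ->
  congN la (fv (bi i)) (fv (bi 0) * (\prod_(bi 0 <= m < bi i) T m
     + (qint q (axial la k l (bi i).-1))^-1 *: phi i)).
Proof.
have [k0 lek l0 El Ec] := kl_facts rem_kl.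
elim: i => // i IH lti.
have Ebi : part_sum la (kj + i.+1) = bi i.+1 by apply: ps_bi.
have Ebi' : part_sum la (kj + i.+1).-1 = bi i.
  by rewrite addnS /=; apply: ps_bi; apply: ltnW.
have row : fv (bi i.+1) = fv (bi i) * (\prod_(bi i <= m < bi i.+1) T m
     + (qint q (axial la k l (bi i.+1).-1))^-1 *: (Rrow K n la (kj + i.+1) : H)).
  rewrite -Ebi -Ebi'; apply: row_fv; first lia.
  by rewrite Ebi Ebi' /bi mulSn; lia.
case: (posnP i) => [i0|i0].
  by rewrite row i0; apply: congN_refl.
have lti' : (0 < i <= h)%N by rewrite i0 ltnW // (proj2 (andP lti)).
have {}IH := IH lti'.
rewrite row; apply: congN_trans (congN_mulr _ IH) _.
set S := \prod_(bi 0 <= m < bi i) T m; set P := \prod_(bi i <= m < bi i.+1) T m.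
have -> : \prod_(bi 0 <= m < bi i.+1) T m = S * P.
  by rewrite /S /P -big_cat_nat //= /bi ?mulSn; lia.
rewrite phiS // -/S; set R := (Rrow _ _ _ _ : H); set F := phi i.
set y := (qint q (axial la k l (bi i).-1))^-1; set z := (qint q (axial la k l (bi i.+1).-1))^-1.
have cb0 : (c <= bi 0)%N by rewrite /c Ec /bi mul0n addn0; apply: part_sum_le.
(* The row ends of a block share a column, so their axial distances increase by one from row to
   row. *)
have yz : z * y + z * q = y.
  have nz i' : (0 < i' <= h)%N -> qint q (axial la k l (bi i').-1) != 0.
    move=> lti''; apply: qint_neq0 => //.
    have := @axial_gt0 n la Sn k l pla rem_kl (bi i').-1; rewrite -/c.
    have := bi_le_n (proj2 (andP lti'')); have := bi_gt0 i'.
    have : (bi 0 < bi i')%N by rewrite /bi; lia.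
    by case: ltgtP => //; lia.
  have rE : axial la k l (bi i.+1).-1 = axial la k l (bi i).-1 + 1 by rewrite !axial_end //; lia.
  have := nz _ lti; have := nz _ lti'; rewrite /y /z rE -(qint_add1 gq).
  set t := qint q _ => t0 t1.
  apply: (mulfI t1); rewrite -mulrDr mulrA mulfV // mul1r mulrDl -mulrA mulfV // mulr1 mul1r.
  by rewrite addrC.
have kill : N la (fv (bi 0) * F * (P + R)).
  (* [P] is the longest coset representative, the one term missing from [R], so [P + R] is the
     complete Garnir sum. *)
  have -> : P + R = \sum_(part_sum la (kj + i) <= x < part_sum la (kj + i) + L.+2)
                  \prod_(part_sum la (kj + i) <= i < x) T i.
    rewrite ps_bi ?(proj2 (andP lti')) // addnS big_nat_recr /=; last by rewrite leq_addr.
    rewrite addrC /R Rrow_block ?(proj2 (andP lti)) // /P.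
    by rewrite (_ : bi i.+1 = bi i + L.+1)%N // /bi mulSn; lia.
  set G := \sum_(_ <= x < _) _.
  (* All letters of [G] have index at least [bi i], beyond the reach of those in [F] and in
     [fv (bi 0)], so [G] can be moved next to [X la]. *)
  have G_comm (x : H) : (forall m, (bi i <= m)%N -> T m * x = x * T m) -> x * G = G * x.
    move=> xT; apply: comm_sum => y'; rewrite mem_index_iota => lty.
    apply: comm_prod => m; rewrite mem_index_iota => ltm; symmetry; apply: xT.
    by rewrite -(ps_bi (proj2 (andP lti'))); lia.
  have ltb : (bi 0 < bi i)%N by rewrite /bi; lia.
  rewrite -mulrA (G_comm F); last by move=> m; apply: phi_T.
  rewrite /seminormal_prod mulrA -[X la * _ * G]mulrA G_comm; last first.
    move=> m lem; apply: comm_prod => x; rewrite mem_index_iota => ltx.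
    by rewrite mulrDr mulrDl -scalerAr -scalerAl mulr1 mul1r -T_comm //; lia.
  rewrite mulrA; do 2!apply: Nbar_mulr.
  have hkj : (h <= size la - kj)%N by rewrite /h; lia.
  apply: garnir_row; first by lia.
    by apply: rowsL; lia.
  by rewrite -addnS; apply: rowsL; lia.
rewrite /Nbar_cong.
have -> : fv (bi 0) * (S + y *: F) * (P + z *: R)
    - fv (bi 0) * (S * P + z *: ((S - q *: F) * R)) = y *: (fv (bi 0) * F * (P + R)).
  by rewrite -mulrA (block_expand S F P R yz) mulrDr addrAC subrr add0r -scalerAr mulrA.
exact: Nbar_scale.
Qed.

End OneBlock.
End Blocks.

(** * The list of removable rows and the row lengths between them *)

Section RemovableNodes.
Variables (n : nat) (la : seq nat) (k l : nat).
Hypothesis pla : is_partition n la.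
Hypothesis rem_kl : removable la (k, l).
Local Notation kk := (kk la k l).
Local Notation ll := (ll la k l).
Local Notation cc := (cc la k l).
Local Notation NN := (NN la k).

Let rows := k :: [seq r <- iota k.+1 (size la - k) | removable la (r, lam la r)].

Let kl : [/\ (0 < k)%N, (k <= size la)%N, (0 < l)%N, l = lam la k & tla la (k, l) = part_sum la k].
Proof. exact: kl_facts rem_kl. Qed.

Let size_rows : size rows = NN.+1.
Proof. by rewrite /= /Defs.NN size_map. Qed.

Let knodeE j : (j <= NN)%N -> knode la k l j = (nth 0%N rows j, lam la (nth 0%N rows j)).
Proof.
move=> lej; rewrite /knode.
have [_ _ _ El _] := kl.
have -> : (k, l) :: nodes_below la k = [seq (r, lam la r) | r <- rows] by rewrite /= -El.
by rewrite (nth_map 0%N) // size_rows ltnS.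
Qed.

Let kkE j : (j <= NN)%N -> kk j = nth 0%N rows j.
Proof. by move=> lej; rewrite /Defs.kk knodeE. Qed.

Lemma llE j : (j <= NN)%N -> ll j = lam la (kk j).
Proof. by move=> lej; rewrite /Defs.ll /Defs.kk knodeE. Qed.

Let sorted_rows : sorted ltn rows.
Proof.
rewrite /= path_min_sorted.
  by apply: sorted_filter; [exact: ltn_trans|exact: iota_ltn_sorted].
by apply/allP => r; rewrite mem_filter mem_iota => /and3P[].
Qed.

Lemma removable_kk j : (j <= NN)%N -> removable la (kk j, ll j).
Proof.
move=> lej; rewrite llE // kkE //.
have : nth 0%N rows j \in rows by rewrite mem_nth // size_rows ltnS.
rewrite inE => /orP[/eqP->|]; last by rewrite mem_filter => /andP[].
by have [_ _ _ <- _] := kl.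
Qed.

Lemma kk_facts j : (j <= NN)%N ->
  [/\ (0 < kk j)%N, (kk j <= size la)%N, (0 < ll j)%N & cc j = part_sum la (kk j)].
Proof.
move=> lej; by have [? ? ? _ Ec] := kl_facts (removable_kk lej).
Qed.

Lemma kk_lt i j : (i < j)%N -> (j <= NN)%N -> (kk i < kk j)%N.
Proof.
move=> ltij lej; rewrite !kkE //; last by rewrite ltnW // (leq_trans ltij).
by apply: (sorted_ltn_nth ltn_trans) => //; rewrite inE size_rows ltnS // ltnW // (leq_trans ltij).
Qed.

Lemma k_le_kk j : (j <= NN)%N -> (k <= kk j)%N.
Proof. by case: j => // j lej; apply: ltnW; apply: (@kk_lt 0). Qed.

Lemma lam_gt0 r : (0 < r <= size la)%N -> (0 < lam la r)%N.
Proof.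
move=> ltr; have /and3P[_ /allP pos _] := pla; apply: pos.
by rewrite /lam; apply: mem_nth; case: r ltr.
Qed.

Lemma removableE r : (0 < r <= size la)%N ->
  removable la (r, lam la r) = (lam la r.+1 < lam la r)%N.
Proof.
move=> ltr; have [r0 ler] := andP ltr.
by rewrite /removable /in_diagram /= eqxx leqnn r0 ler (lam_gt0 ltr).
Qed.

Lemma mem_rows r : (k < r <= size la)%N -> (lam la r.+1 < lam la r)%N ->
  exists2 i, (i <= NN)%N & r = kk i.
Proof.
move=> ltr lt; have rr : r \in rows.
  rewrite inE mem_filter removableE ?lt ?mem_iota; last lia.
  by apply/orP; right; apply/andP; split => //; lia.
have lei : (index r rows <= NN)%N by rewrite -ltnS -size_rows index_mem.
by exists (index r rows) => //; rewrite kkE // nth_index.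
Qed.

(** A drop in length strictly between two consecutive removable rows would itself produce a
    removable row, listed strictly between neighbours of a sorted list. *)
Lemma lam_block j r : (j < NN)%N -> (kk j < r <= kk j.+1)%N -> lam la r = ll j.+1.
Proof.
move=> ltj; rewrite llE //; have [_ leS _ _] := kk_facts ltj.
move=> ltr; move: {2}(kk j.+1 - r)%N (erefl (kk j.+1 - r)%N) => t.
elim: t r ltr => [|t IH] r ltr Et; first by congr lam; lia.
rewrite -(IH r.+1); [|lia|lia].
apply/eqP; rewrite eqn_leq; have [k0 _ _ _ _] := kl.
apply/andP; split; last by apply: (lam_mono pla); lia.
rewrite leqNgt; apply/negP => lt.
have lek := k_le_kk (ltnW ltj).
have [|i lei Ei] := @mem_rows r _ lt; first lia.
case: (ltngtP i j) => [ltij|ltji|Eij].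
- by have := kk_lt ltij (ltnW ltj); lia.
- case: (ltngtP i j.+1) => [|ltji'|Eij]; first lia.
    by have := kk_lt ltji' lei; lia.
  by rewrite Eij in Ei; lia.
by rewrite Eij in Ei; lia.
Qed.

(** The bottom row always ends in a removable node; this is what makes the recursion end at the
    entry [n]. *)
Lemma kk_last : kk NN = size la.
Proof.
have [k0 lek _ _ _] := kl; have [_ leN _ _] := kk_facts (leqnn NN).
move: lek; rewrite leq_eqVlt => /orP[/eqP Ek|ltk].
  by apply/eqP; rewrite eqn_leq leN -Ek k_le_kk.
have lt : (lam la (size la).+1 < lam la (size la))%N.
  by rewrite {1}/lam nth_default // lam_gt0 // leqnn andbT; lia.
have [|i lei Ei] := @mem_rows (size la) _ lt; first by rewrite ltk leqnn.
move: lei; rewrite leq_eqVlt => /orP[/eqP <-//|lti].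
by have := kk_lt lti (leqnn _); rewrite -Ei; lia.
Qed.

End RemovableNodes.

Section SeminormalEquality.
Variables (K : fieldType) (q : K) (n : nat) (la : seq nat) (k l : nat).
Hypothesis gq : generic q.
Hypothesis pla : is_partition n la.
Hypothesis rem_kl : removable la (k, l).
Local Notation H := (heckeAlg q n).
Local Notation T := (@genT K q n).
Local Notation congN := (@Nbar_cong K q n).
Local Notation fv := (@seminormal_prod K q n la k l).

Lemma fv_ftilde j : (j <= NN la k)%N ->
  congN la (fv (part_sum la (kk la k l j))) (ftilde q n la k l j : H).
Proof.
elim: j => [_|j IH ltj].
  have [_ _ _ _ Ec] := kl_facts rem_kl.
  by rewrite /seminormal_prod /= -Ec big_geq // mulr1; apply: congN_refl.
have {}IH := IH (ltnW ltj).
have [kj0 lekj lj0 cj] := kk_facts rem_kl (ltnW ltj).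
have [kS0 lekS lS0 cS] := kk_facts rem_kl ltj.
have ltkk := kk_lt rem_kl (ltnSn j) ltj.
have rows i : (0 < i <= kk la k l j.+1 - kk la k l j)%N ->
    lam la (kk la k l j + i) = (ll la k l j.+1).-1.+1.
  by move=> lti; rewrite (lam_block pla rem_kl ltj) ?prednK //; lia.
have llj : ll la k l j.+1 = (ll la k l j.+1).-1.+1 by rewrite prednK.
set h := (kk la k l j.+1 - kk la k l j)%N in rows.
have lth : (0 < h <= h)%N by rewrite /h; lia.
have lek := k_le_kk rem_kl (ltnW ltj).
have B := block_fv gq pla rem_kl cj lek lekS llj rows lth.
have Eh : (kk la k l j + h = kk la k l j.+1)%N by rewrite /h; lia.
rewrite /= -(part_sum_block rows (leq0n _)) -(part_sum_block rows (leqnn _)) Eh addn0 in B.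
apply: congN_trans B _; apply: congN_trans (congN_mulr _ IH) _.
have -> : (ftilde q n la k l j.+1 : H) = (ftilde q n la k l j : H) *
   (basisT q (sigt n la k l j) + (qint q (rdist la k l j.+1))^-1 *: (FF q n la k l j : H)).
  by rewrite mulHE.
rewrite TT_sig; first last.
- by rewrite cS; apply: part_sum_le_n pla _.
- by rewrite cj; apply: (part_sum_gt0 rem_kl).
rewrite cj cS (_ : rdist la k l j.+1 = axial la k l (part_sum la (kk la k l j.+1)).-1).
  exact: congN_refl.
rewrite -[kk la k l j.+1]prednK // /axial content_row_end prednK // -(llE rem_kl ltj) //.
by rewrite /rdist /corner_content; lia.
Qed.

Lemma ftilde_f_n : congN la (ftilde q n la k l (NN la k) : H) (f_n q n la k l : H).
Proof.
apply: congN_trans (congN_sym (fv_ftilde (leqnn _))) _.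
rewrite (kk_last pla rem_kl) part_sum_full //.
have /and3P[_ _ /eqP ->] := pla.
exact: congN_sym (f_n_fv gq pla rem_kl).
Qed.

End SeminormalEquality.

(** * Standardness *)

Section Words.
Variable (la : seq nat).
Implicit Types (w : seq nat).

Lemma sorted_ltn_rcons w g : sorted ltn (rcons w g) ->
  sorted ltn w /\ forall i, i \in w -> (i < g)%N.
Proof.
move=> sw; split; first by apply: subseq_sorted sw; [exact: ltn_trans|exact: subseq_rcons].
elim: w sw => //= a w IH pw i.
have /allP lta := order_path_min ltn_trans pw.
rewrite inE => /orP[/eqP->|]; first by apply: lta; rewrite mem_rcons mem_head.
by apply: IH; apply: path_sorted pw.
Qed.

(** Letter [g] exchanges the zero-based values [g-1] and [g], and letters come in increasing order.
    So a value in [w] drops by one at its own letter and is never touched again, while a value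
    outside [w] climbs through the run of letters that follows it. *)
Lemma word_perm_val n w (x : 'I_n) : sorted ltn w -> all (fun g => 0 < g < n)%N w ->
  if (x : nat) \in w then word_perm n w x = x.-1 :> nat
  else (x <= word_perm n w x)%N /\ forall i, (x < i <= word_perm n w x)%N -> i \in w.
Proof.
elim/last_ind: w => [|w g IH] sw rw.
  by rewrite /word_perm big_nil perm1; split=> // i; case: ltngtP.
have [sw' ltg] := sorted_ltn_rcons sw.
move: rw; rewrite all_rcons => /andP[rg rw]; have {IH} := IH sw' rw.
have -> : word_perm n (rcons w g) = (word_perm n w * sgen n g)%g.
  by rewrite /word_perm -cats1 big_cat big_seq1.
rewrite permM sgenE // mem_rcons inE; set z := word_perm n w x.
case: ifP => xw; last first.
  move=> [lexz zw]; have [Exg|nxg] /= := eqVneq (x : nat) g.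
    have Ez : z = x :> nat.
      apply/eqP; rewrite eqn_leq lexz andbT leqNgt; apply/negP => ltxz.
      by have /ltg : (x : nat).+1 \in w; [apply: zw; rewrite ltnSn|rewrite Exg; lia].
    by rewrite Ez Exg eqxx; case: eqP => //; lia.
  have [Ezg|nzg] := eqVneq (z : nat) g.-1.
    split=> [|i lti]; first by move: lexz; rewrite Ezg; lia.
    rewrite mem_rcons inE; have [//|nig] /= := eqVneq i g.
    by apply: zw; rewrite Ezg; lia.
  have [Ezg|nzg'] := eqVneq (z : nat) g.
    case/negP: nxg; apply/eqP; apply/eqP; rewrite eqn_leq -{1}Ezg lexz /= leqNgt.
    apply/negP => ltxg; have gw : g \in w by apply: zw; rewrite Ezg ltxg leqnn.
    by have := ltg _ gw; rewrite ltnn.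
  by split=> // i lti; rewrite mem_rcons inE zw ?orbT.
rewrite orbT => Ez; have := ltg _ xw; rewrite Ez.
have x0 : (0 < x)%N by have /andP[] := allP rw _ xw.
by do 2!(case: eqP; first lia).
Qed.

(* A run of consecutive letters starting at [g] slides the entry [g] upwards; the
   last two clauses keep it from passing the right and the lower neighbour of
   its node. *)
Definition admissible (u v : nat) w :=
  [/\ sorted ltn w, (forall g, g \in w -> (u <= g < v)%N),
      (forall g, g \in w -> g.-1 \notin w -> g \in breaks la)
    & (forall r, (0 < r < size la)%N -> lam la r.+1 = lam la r ->
         (part_sum la r.+1).-1 \in w -> (part_sum la r).-1 \in w)].

Lemma admissible_nil u v : admissible u v [::].
Proof. by []. Qed.

Lemma admissible_cat u v v' w w' : (u <= v)%N -> (v <= v')%N ->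
  admissible u v w -> admissible v v' w' -> admissible u v' (w ++ w').
Proof.
move=> leuv levv [s1 r1 b1 c1] [s2 r2 b2 c2]; split.
- rewrite sorted_pairwise; last exact: ltn_trans.
  rewrite pairwise_cat -!sorted_pairwise ?s1 ?s2 ?andbT; try exact: ltn_trans.
  by apply/allrelP => a b /r1 la1 /r2 lb; lia.
- by move=> g; rewrite mem_cat => /orP[/r1|/r2]; lia.
- move=> g; rewrite !mem_cat negb_or => /orP[gw|gw] /andP[n1 n2]; [exact: b1|exact: b2].
by move=> r ltr E; rewrite !mem_cat => /orP[/(c1 r ltr E)->|/(c2 r ltr E)->]; rewrite ?orbT.
Qed.

(** A prefix of an increasing word keeps all letters of [w] below its own, and the last two
    conditions refer only to smaller letters. *)
Lemma admissible_take u v w p : admissible u v w -> admissible u v (take p w).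
Proof.
move=> [s1 r1 b1 c1].
have st : sorted ltn (take p w) by apply: take_sorted.
have mt g : g \in take p w -> g \in w by apply: mem_take.
have low g g' : g \in take p w -> (g' <= g)%N -> g' \in w -> g' \in take p w.
  move=> gt le g'w; rewrite -(cat_take_drop p w) mem_cat in g'w.
  case/orP: g'w => // g'd; move: s1; rewrite -(cat_take_drop p w) sorted_pairwise; last exact: ltn_trans.
  rewrite pairwise_cat => /andP[/allrelP ar _].
  by have := ar _ _ gt g'd; rewrite /= ltnNge le.
split=> // [g /mt/r1 //|g gt ng|r ltr E rt].
  apply: b1; first exact: mt.
  by apply: contra ng => gw; apply: (low g) => //; apply: leq_pred.
apply: (low _ _ rt); last by apply: c1 => //; apply: mt.
by have := part_sum_le la (leqnSn r); lia.
Qed.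

Lemma tla_lt n r c : sumn la = n -> in_diagram la (r, c) ->
  (part_sum la r.-1 < tla la (r, c) <= n)%N.
Proof.
move=> Sn /and4P[/= r0 ler c0 lec]; rewrite /tla /= -Sn.
have : (part_sum la r <= sumn la)%N.
  by rewrite -(part_sum_full (leqnn (size la))); apply: part_sum_le.
by rewrite -[r]prednK // part_sumS prednK //=; lia.
Qed.

(** If [x < y] are inverted, then [x] is not in [w] but [x+1, ..., y] are, so a run starts at [x+1].
    For right neighbours it would start inside a row. For lower neighbours it starts at a row end,
    which forces two rows of equal length, and the last condition then puts [x] in [w]. *)
Lemma admissible_standard n w : is_partition n la -> admissible 1 n w ->
  standard la (word_perm n w).
Proof.
move=> pla [sw rw bw cw]; have /and3P[_ _ /eqP Sn] := pla.
have rg : all (fun g => 0 < g < n)%N w by apply/allP.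
set d := word_perm n w.
have inv (x y : 'I_n) : (x < y)%N -> ~~ (d x < d y)%N ->
    (x : nat) \notin w /\ forall i, (x < i <= y)%N -> i \in w.
  move=> ltxy ndxy; have := word_perm_val x sw rg; have := word_perm_val y sw rg.
  rewrite -/d => Dy Dx.
  have ley : (y.-1 <= d y)%N by move: Dy; case: ifP => _; [move=> ->|move=> [? _]; lia].
  case: ifP Dx => xw Dx; first by have /andP[] := allP rg _ xw; lia.
  have ned : (d x : nat) <> d y by move=> /val_inj/perm_inj E; move: ltxy; rewrite E ltnn.
  by split=> // i lti; apply: (proj2 Dx); lia.
have entryE r c : in_diagram la (r, c) -> exists2 x : 'I_n,
    (x : nat).+1 = tla la (r, c) & entry la d (r, c) = (d x).+1.
  move=> din; have lt := tla_lt Sn din.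
  have ltx : ((tla la (r, c)).-1 < n)%N by lia.
  exists (Ordinal ltx); first by rewrite /= prednK //; lia.
  by rewrite /entry (insubT (fun x => x < n)%N ltx).
move=> r c din; have [x Ex ->] := entryE r c din.
have /and4P[/= r0 ler c0 lec] := din.
have Er : part_sum la r = (part_sum la r.-1 + lam la r)%N by rewrite -{1}[r]prednK // part_sumS prednK.
split=> din'; have [y Ey ->] := entryE _ _ din'; rewrite ltnS; apply/negPn/negP => nlt.
  have ltxy : (x < y)%N by move: Ex Ey; rewrite /tla /=; lia.
  have [xw yw] := inv x y ltxy nlt.
  have Eyx : y = x.+1 :> nat by move: Ex Ey; rewrite /tla /=; lia.
  have : (y : nat) \in breaks la by apply: bw; rewrite ?Eyx //; apply: yw; rewrite Eyx ltnSn /=.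
  apply/negP; apply: (@notin_breaks _ r.-1); rewrite prednK // Er.
  by have /and4P[/= _ _ _] := din'; move: Ex; rewrite /tla /= Eyx; lia.
have /and4P[/= _ lerS _ lecS] := din'.
have lelam : (lam la r.+1 <= lam la r)%N by apply: (lam_mono pla); lia.
have ltxy : (x < y)%N by move: Ex Ey; rewrite /tla /= Er; lia.
have [xw yw] := inv x y ltxy nlt.
have xb : (x : nat).+1 \in breaks la by apply: bw => //=; apply: yw; rewrite ltnSn.
have Ec : c = lam la r.
  apply/eqP; rewrite eqn_leq lec leqNgt; apply/negP => ltc; move: xb; apply/negP.
  by apply: (@notin_breaks _ r.-1); rewrite prednK // Er Ex /tla /=; lia.
have Elam : lam la r.+1 = lam la r by lia.
have Eyy : (part_sum la r.+1).-1 = y by move: Ey; rewrite part_sumS /tla /=; lia.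
have Exx : (part_sum la r).-1 = x by move: Ex; rewrite /tla /= Er; lia.
have ltr : (0 < r < size la)%N by rewrite r0.
have yw' : (y : nat) \in w by apply: yw; rewrite ltxy leqnn.
by have := cw r ltr Elam; rewrite Eyy Exx (negPf xw) => /(_ yw').
Qed.

Lemma admissible_row r t : (1 < r <= size la)%N -> (0 < part_sum la r.-1)%N ->
  (part_sum la r.-1 + t < part_sum la r)%N ->
  admissible (part_sum la r.-1) (part_sum la r) (iota (part_sum la r.-1) t).
Proof.
move=> ltr a0 ltt; set a := part_sum la r.-1 in a0 ltt *; split.
- exact: iota_ltn_sorted.
- by move=> g; rewrite mem_iota; lia.
- move=> g; rewrite !mem_iota => gw ngw; have -> : g = a by lia.
  by rewrite /a (_ : r.-1 = r.-2.+1) ?mem_breaks //; lia.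
(* The run is too short to contain the letter [part_sum la r - 1], so the last condition is void. *)
move=> r' ltr' _; rewrite mem_iota => r'w; exfalso.
case: (leqP r'.+1 r.-1) => le; first by have := part_sum_le la le; rewrite -/a; lia.
have le' : (r <= r'.+1)%N by lia.
by have := part_sum_le la le'; lia.
Qed.

Lemma admissible_sig n r s : is_partition n la -> removable la (r, lam la r) ->
  (r <= s <= size la)%N ->
  admissible (part_sum la r) (part_sum la s) (iota (part_sum la r) (part_sum la s - part_sum la r)).
Proof.
move=> pla rem_r lers; have [r0 ler l0 _ _] := kl_facts rem_r.
have /and3P[_ _ /= ltlam] := rem_r.
have le := part_sum_le la (proj1 (andP lers)).
have Er : part_sum la r = (part_sum la r.-1 + lam la r)%N by rewrite -{1}[r]prednK // part_sumS prednK.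
split.
- exact: iota_ltn_sorted.
- by move=> g; rewrite mem_iota; lia.
- move=> g; rewrite !mem_iota => gw ngw; have -> : g = part_sum la r by lia.
  by rewrite -[r]prednK // mem_breaks //; lia.
move=> r' ltr' E; rewrite !mem_iota => r'w.
have ltrr' : (r < r'.+1)%N.
  by rewrite ltnNge; apply/negP => le'; have := part_sum_le la le'; lia.
(* Removability makes row [r+1] strictly shorter than row [r], which excludes [r' = r], the one case
   where the required letter would lie before the run. *)
have ltrr'' : (r < r')%N.
  by rewrite ltn_neqAle -ltnS ltrr' andbT; apply: contraTneq ltlam => ->; rewrite E ltnn.
have lS : (0 < lam la r.+1)%N by apply: (lam_gt0 pla); lia.
by have := part_sum_le la ltrr''; have := part_sum_le la (leqnSn r'); rewrite (part_sumS la r); lia.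
Qed.

End Words.

(** * Words occurring in the multiplied-out recursion *)

Section Expansion.
Variables (K : fieldType) (q : K) (n : nat) (la : seq nat) (k l : nat).
Hypothesis pla : is_partition n la.
Hypothesis rem_kl : removable la (k, l).
Local Notation kk := (kk la k l).
Local Notation cc := (cc la k l).
Local Notation NN := (NN la k).

Lemma fmul_word (a b : fexpr K) x : x \in fmul a b ->
  exists y z, [/\ y \in a, z \in b & x.2 = y.2 ++ z.2].
Proof. by case/allpairsP => -[y z] [ya zb ->]; exists y, z. Qed.

Lemma fRrow_admissible r x : (1 < r <= size la)%N -> (0 < part_sum la r.-1)%N ->
  x \in fRrow K la r -> admissible la (part_sum la r.-1) (part_sum la r) x.2.
Proof.
move=> ltr a0 /flattenP[_ /mapP[j + ->]].
rewrite mem_iota inE /aa /bb => ltj /eqP -> /=.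
by apply: admissible_row => //; lia.
Qed.

(** Both summands of the bracket supply words whose letters stay below the boundary of the next row,
    so appending a run inside that row preserves admissibility. *)
Lemma fphi_admissible j i x : (j < NN)%N -> (0 < i <= kk j.+1 - kk j)%N ->
  x \in fphi q la k l j i -> admissible la (cc j) (part_sum la (kk j + i)) x.2.
Proof.
move=> ltj; have [kj0 lekj lj0 cj] := kk_facts rem_kl (ltnW ltj).
have [kS0 lekS lS0 cS] := kk_facts rem_kl ltj.
have cj0 : (0 < cc j)%N by rewrite /Defs.cc /tla -/(ll la k l j); lia.
have rowsL t : (0 < t <= kk j.+1 - kk j)%N -> lam la (kk j + t) = ll la k l j.+1.
  by move=> ltt; apply: (lam_block pla rem_kl ltj); lia.
have psE t : (t <= kk j.+1 - kk j)%N -> part_sum la (kk j + t) = (cc j + t * ll la k l j.+1)%N.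
  by rewrite cj; apply: part_sum_block.
have row t y : (t < kk j.+1 - kk j)%N -> y \in fRrow K la (kk j + t.+1) ->
    admissible la (part_sum la (kk j + t)) (part_sum la (kk j + t.+1)) y.2.
  move=> ltt yR; have := @fRrow_admissible (kk j + t.+1) y; rewrite addnS /=; apply.
  - by lia.
  - by rewrite psE; lia.
  by rewrite -addnS.
elim: i x => // i IH x lti; case: (posnP i) => [i0|i0].
  rewrite i0 => xR; have := row 0%N x; rewrite addn0 -cj; apply=> //; lia.
have -> : fphi q la k l j i.+1 =
    fmul (fadd (fTij K (cc j) (cc j + i * ll la k l j.+1)) (fscale (- q) (fphi q la k l j i)))
         (fRrow K la (kk j + i.+1)) by case: (i) i0.
case/fmul_word => y [z [yin zR ->]].
have lti' : (0 < i <= kk j.+1 - kk j)%N by lia.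
apply: (@admissible_cat _ _ (part_sum la (kk j + i))).
- by rewrite psE; lia.
- by apply: part_sum_le; lia.
- move: yin; rewrite mem_cat => /orP[|/mapP[y' y'in ->]]; last exact: (IH y').
  rewrite inE => /eqP -> /=; rewrite -psE; last lia.
  rewrite cj; apply: (admissible_sig pla); last lia.
  by rewrite -(llE rem_kl (ltnW ltj)); apply: (removable_kk rem_kl (ltnW ltj)).
by apply: row => //; lia.
Qed.

Lemma fexpand_admissible j x : (j <= NN)%N ->
  x \in fexpand q la k l j -> admissible la (cc 0) (cc j) x.2.
Proof.
elim: j x => [|j IH] x ltj; first by rewrite inE => /eqP ->; apply: admissible_nil.
have [_ _ _ c_0] := kk_facts rem_kl (leq0n NN).
have [kj0 lekj lj0 cj] := kk_facts rem_kl (ltnW ltj).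
have [kS0 lekS lS0 cS] := kk_facts rem_kl ltj.
have ltkk := kk_lt rem_kl (ltnSn j) ltj.
move=> /fmul_word[y [z [yin zin ->]]].
apply: (@admissible_cat _ _ (cc j)).
- by rewrite c_0 cj; apply: part_sum_le; apply: (k_le_kk rem_kl (ltnW ltj)).
- by rewrite cj cS; apply: part_sum_le; apply: ltnW.
- exact: (IH y (ltnW ltj)).
move: zin; rewrite mem_cat => /orP[|/mapP[y' y'in ->]].
  rewrite inE => /eqP -> /=; rewrite cS cj; apply: (admissible_sig pla).
    by rewrite -(llE rem_kl (ltnW ltj)); apply: (removable_kk rem_kl (ltnW ltj)).
  by rewrite (ltnW ltkk).
have Eh : (kk j + (kk j.+1 - kk j) = kk j.+1)%N by lia.
rewrite /= cS -Eh; apply: fphi_admissible y'in => //; lia.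
Qed.

End Expansion.

(** A nonempty sum of powers of the indeterminate takes at 1 the number of its terms as value, which
    is nonzero in characteristic 0. *)
Lemma generic_qvar (R : realType) : generic (qvar R).
Proof.
split; first by rewrite /qvar tofrac_eq0 polyX_eq0.
  rewrite /qvar -tofrac1 tofrac_eq; apply/eqP => /(congr1 (horner^~ 0)) /eqP.
  by rewrite hornerX hornerC eq_sym oner_eq0.
move=> s s0; have -> : \sum_(i <- s) qvar R ^+ i = FracField.tofrac (\sum_(i <- s) 'X^i).
  by rewrite rmorph_sum; apply: eq_bigr => i _; rewrite rmorphXn.
rewrite tofrac_eq0; apply/eqP => /(congr1 (horner^~ 1)) /eqP; rewrite horner_sum horner0.
rewrite (eq_bigr (fun=> 1)); last by move=> i _; rewrite hornerXn expr1n.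
by rewrite big_const_seq count_predT iter_addr_0 pnatr_eq0 size_eq0 (negPf s0).
Qed.

Theorem theorem1 (R : realType) (n : nat) (la : seq nat) (k l : nat) :
  is_partition n la -> removable la (k, l) ->
  (* f~_N = f_n in S^lambda *)
  @specht_eq _ (qvar R) n la (ftilde (qvar R) n la k l (NN la k))
                 (f_n (qvar R) n la k l)
  /\
  (* every e_t arising when f~_N is multiplied out and e_t T_i is
     evaluated as e_{t s_i} has t standard *)
  (forall x, x \in fexpand (qvar R) la k l (NN la k) ->
     forall p, (p <= size x.2)%N ->
       standard la (word_perm n (take p x.2))).
Proof.
move=> pla rem_kl; split; first exact: (ftilde_f_n (generic_qvar R) pla rem_kl).
move=> x xin p _; apply: (admissible_standard pla).
have := admissible_take p (fexpand_admissible pla rem_kl (leqnn _) xin).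
have [_ _ l0 c_N] := kk_facts rem_kl (leqnn (NN la k)).
have c_0 : (0 < cc la k l 0)%N by exact: (c_gt0 rem_kl).
rewrite c_N (kk_last pla rem_kl) part_sum_full //; have /and3P[_ _ /eqP ->] := pla.
by move=> [s1 r1 b1 c1]; split=> // g /r1; lia.
Qed.
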